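(* Let $E\in\mathrm{PU}(2,1)$ be a regular elliptic isometry with angle pair $\{\theta_1,\theta_2\}$, normalized so that $0<\theta_2<\theta_1<2\pi$. Then $E$ is a product of three involutions of $\mathrm{PU}(2,1)$ if and only if the point $(\theta_1,\theta_2)\in\mathbb{R}^2$ lies outside the two open triangles $T$ and $T'$ with vertices $$T:\ (\pi,\pi),\ \left(\tfrac{2\pi}{3},\tfrac{\pi}{3}\right),\ \left(\tfrac{\pi}{2},\tfrac{\pi}{2}\right)\qquad\text{and}\qquad T':\ (\pi,\pi),\ \left(\tfrac{5\pi}{3},\tfrac{4\pi}{3}\right),\ \left(\tfrac{3\pi}{2},\tfrac{3\pi}{2}\right).$$
   Context: $\mathbb{C}^{2,1}$ is $\mathbb{C}^3$ with a Hermitian form of signature $(2,1)$; $\mathrm{PU}(2,1)$ is the projectivized unitary group of this form, acting on the complex hyperbolic plane $\mathrm{H}^2_{\mathbb{C}}\subset\mathbb{CP}^2$ of negative lines. An element is elliptic if it fixes a point of $\mathrm{H}^2_{\mathbb{C}}$; it then has a lift to $\mathrm{U}(2,1)$ which is diagonalizable in an orthogonal basis with unit-modulus eigenvalues $e^{i\alpha},e^{i\beta}$ (with positive eigenvectors) and $e^{i\gamma}$ (with a negative eigenvector). Its angle pair is the unordered pair $\{\alpha-\gamma,\beta-\gamma\}$ of angles modulo $2\pi$; it determines the conjugacy class. The elliptic element is regular if its lifts have three distinct eigenvalues, equivalently if its two angles are nonzero and distinct modulo $2\pi$. An involution is an element of order $2$. *)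

(* Defs.v *)
From HB Require Import structures.
From mathcomp Require Import all_boot all_order all_algebra generic_quotient.
From mathcomp Require Import complex.
From mathcomp Require Import all_classical all_reals all_analysis.

Set Implicit Arguments.
Unset Strict Implicit.
Unset Printing Implicit Defensive.

Import Order.TTheory GRing.Theory Num.Theory.

Local Open Scope classical_set_scope.
Local Open Scope ring_scope.
Local Open Scope complex_scope.
Local Open Scope quotient_scope.

(** The space C^{2,1} is C^3, as column vectors, with an arbitrary Hermitian form
    of signature (2,1) given by its Gram matrix [H]; isometries act on the left. *)

Section HermitianForm.
Context {R : realType}.
Local Notation C := R[i].
Implicit Types (H A P : 'M[C]_3) (v w : 'cV[C]_3).

Definition adjoint m n (A : 'M[C]_(m, n)) : 'M[C]_(n, m) :=
  map_mx Num.conj A^T.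

Lemma adjoint_mul m n p (A : 'M[C]_(m, n)) (B : 'M[C]_(n, p)) :
  adjoint (A *m B) = adjoint B *m adjoint A.
Proof. by rewrite /adjoint trmx_mul map_mxM. Qed.

Lemma adjoint1 n : adjoint (1%:M : 'M[C]_n) = 1%:M.
Proof. by rewrite /adjoint trmx1 map_mx1. Qed.

(** Linear in [v], antilinear in [w]. *)
Definition herm H v w : C := (adjoint w *m H *m v) 0 0.

(** The columns of [P] form an orthogonal basis, the first two vectors being
    positive and the third one negative.  (In the partial order of [R[i]],
    [0 < x] and [x < 0] include that [x] is real.) *)
Definition orthogonal_basis21 H P : Prop :=
  [/\ P \in unitmx,
      forall i j : 'I_3, i != j -> herm H (col i P) (col j P) = 0,
      0 < herm H (col 0 P) (col 0 P),
      0 < herm H (col 1 P) (col 1 P)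
    & herm H (col 2 P) (col 2 P) < 0].

Definition signature21 H : Prop :=
  adjoint H = H /\ exists P, orthogonal_basis21 H P.

Definition preserves_form H A : bool :=
  (A \in unitmx) && (adjoint A *m H *m A == H).

End HermitianForm.

Definition U21 (R : realType) (H : 'M[R[i]]_3) : Type :=
  {A : 'M[R[i]]_3 | preserves_form H A}.

HB.instance Definition _ (R : realType) (H : 'M[R[i]]_3) :=
  SubChoice.copy (U21 H) {A : 'M[R[i]]_3 | preserves_form H A}.

Section UnitaryGroup.
Context {R : realType} (H : 'M[R[i]]_3).
Implicit Types (A B : 'M[R[i]]_3) (u : U21 H).

Lemma preserves_form1 : preserves_form H 1%:M.
Proof. by rewrite /preserves_form unitmx1 adjoint1 mul1mx mulmx1 eqxx. Qed.

Lemma preserves_formM A B :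
  preserves_form H A -> preserves_form H B -> preserves_form H (A *m B).
Proof.
move=> /andP[uA /eqP hA] /andP[uB /eqP hB].
rewrite /preserves_form unitmx_mul uA uB adjoint_mul.
by rewrite !mulmxA -(mulmxA (adjoint B)) -(mulmxA (adjoint B)) hA hB eqxx.
Qed.

Lemma preserves_formV A : preserves_form H A -> preserves_form H (invmx A).
Proof.
move=> /andP[uA /eqP hA]; rewrite /preserves_form unitmx_inv uA -{1}hA.
by rewrite !mulmxA -adjoint_mul mulmxV // adjoint1 mul1mx mulmxK ?eqxx.
Qed.

Definition U21_one : U21 H := Sub 1%:M preserves_form1.
Definition U21_mul u1 u2 : U21 H :=
  Sub (val u1 *m val u2) (preserves_formM (valP u1) (valP u2)).
Definition U21_inv u : U21 H := Sub (invmx (val u)) (preserves_formV (valP u)).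

Lemma U21_unit u : val u \in unitmx.
Proof. by case/andP: (valP u). Qed.

Lemma U21_mulA : associative U21_mul.
Proof. by move=> a b c; apply: val_inj; rewrite !SubK mulmxA. Qed.
Lemma U21_mul1l : left_id U21_one U21_mul.
Proof. by move=> a; apply: val_inj; rewrite !SubK mul1mx. Qed.
Lemma U21_mul1r : right_id U21_one U21_mul.
Proof. by move=> a; apply: val_inj; rewrite !SubK mulmx1. Qed.
Lemma U21_mulVl : left_inverse U21_one U21_inv U21_mul.
Proof. by move=> a; apply: val_inj; rewrite !SubK mulVmx // U21_unit. Qed.
Lemma U21_mulVr : right_inverse U21_one U21_inv U21_mul.
Proof. by move=> a; apply: val_inj; rewrite !SubK mulmxV // U21_unit. Qed.

HB.instance Definition _ :=
  isGroup.Build (U21 H) U21_mulA U21_mul1l U21_mul1r U21_mulVl U21_mulVr.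

(** When [u1] and [u2] are unitary for a nonzero form, the scalar [c] automatically has modulus 1. *)
Definition proportional (u1 u2 : U21 H) : bool :=
  `[< exists2 c : R[i], c != 0 & val u1 = c *: val u2 >].

Lemma proportional_refl : reflexive proportional.
Proof. by move=> u; apply/asboolP; exists 1; rewrite ?oner_neq0 ?scale1r. Qed.

Lemma proportional_sym : symmetric proportional.
Proof.
suff imp u1 u2 : proportional u1 u2 -> proportional u2 u1.
  by move=> u1 u2; apply/idP/idP; exact: imp.
move=> /asboolP[c c0 e]; apply/asboolP; exists c^-1; first by rewrite invr_eq0.
by rewrite e scalerA mulVf // scale1r.
Qed.

Lemma proportional_trans : transitive proportional.
Proof.
move=> u2 u1 u3 /asboolP[c c0 e] /asboolP[d d0 f]; apply/asboolP.
by exists (c * d); [rewrite mulf_neq0 | rewrite e f scalerA].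
Qed.

Canonical proportional_equiv :=
  EquivRel proportional proportional_refl proportional_sym proportional_trans.

Definition PU21 : Type := {eq_quot proportional}.
HB.instance Definition _ := Choice.on PU21.
HB.instance Definition _ := EqQuotient.on PU21.

Definition PU21_one : PU21 := \pi_PU21 (1%g : U21 H).
Definition PU21_mul (g1 g2 : PU21) : PU21 := \pi_PU21 (repr g1 * repr g2 : U21 H)%g.
Definition PU21_inv (g : PU21) : PU21 := \pi_PU21 ((repr g)^-1 : U21 H)%g.

Lemma PU21_eqP u1 u2 :
  reflect (exists2 c : R[i], c != 0 & val u1 = c *: val u2)
          (\pi_PU21 u1 == \pi_PU21 u2).
Proof. by rewrite piE; exact: asboolP. Qed.

Lemma PU21_piM u1 u2 : PU21_mul (\pi u1) (\pi u2) = \pi_PU21 (u1 * u2 : U21 H)%g.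
Proof.
rewrite /PU21_mul; apply/eqP/PU21_eqP.
have /eqP/PU21_eqP[c c0 e] := reprK (\pi_PU21 u1).
have /eqP/PU21_eqP[d d0 f] := reprK (\pi_PU21 u2).
exists (c * d); first by rewrite mulf_neq0.
by rewrite /mul/= e f -scalemxAl -scalemxAr scalerA.
Qed.

Lemma PU21_piV u : PU21_inv (\pi u) = \pi_PU21 (u^-1 : U21 H)%g.
Proof.
rewrite /PU21_inv; apply/eqP/PU21_eqP.
have /eqP/PU21_eqP[c c0 e] := reprK (\pi_PU21 u).
exists c^-1; first by rewrite invr_eq0.
by rewrite /inv/= e invmxZ // -e U21_unit.
Qed.

Lemma PU21_mulA : associative PU21_mul.
Proof.
by move=> a b c; rewrite -[a]reprK -[b]reprK -[c]reprK !PU21_piM mulgA.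
Qed.
Lemma PU21_mul1l : left_id PU21_one PU21_mul.
Proof. by move=> a; rewrite -[a]reprK PU21_piM mul1g. Qed.
Lemma PU21_mul1r : right_id PU21_one PU21_mul.
Proof. by move=> a; rewrite -[a]reprK PU21_piM mulg1. Qed.
Lemma PU21_mulVl : left_inverse PU21_one PU21_inv PU21_mul.
Proof. by move=> a; rewrite -[a]reprK PU21_piV PU21_piM mulVg. Qed.
Lemma PU21_mulVr : right_inverse PU21_one PU21_inv PU21_mul.
Proof. by move=> a; rewrite -[a]reprK PU21_piV PU21_piM mulgV. Qed.

HB.instance Definition _ :=
  isGroup.Build PU21 PU21_mulA PU21_mul1l PU21_mul1r PU21_mulVl PU21_mulVr.

End UnitaryGroup.

Section Isometries.
Context {R : realType} {H : 'M[R[i]]_3}.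
Local Notation C := R[i].
Implicit Types (g E : PU21 H) (u : U21 H) (L : set 'cV[C]_3).

Definition lift_of g u : Prop := \pi_(PU21 H) u = g.

(** Points of CP^2 are lines through the origin, seen as sets of vectors. *)
Definition cline (v : 'cV[C]_3) : set 'cV[C]_3 := [set c *: v | c in [set: C]].

Definition H2C : set (set 'cV[C]_3) :=
  [set cline v | v in [set v | herm H v v < 0]].

(** The result does not depend on the lift [repr g]. *)
Definition proj_act g L : set 'cV[C]_3 := mulmx (val (repr g)) @` L.

Definition elliptic g : Prop := exists2 L, H2C L & proj_act g L = L.

Definition regular_elliptic g : Prop :=
  elliptic g /\
  forall u, lift_of g u ->
    exists s : seq C, [/\ size s = 3, uniq s & all (eigenvalue (val u)) s].

Definition expi (t : R) : C := cos t +i* sin t.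

Definition eq_mod2pi (x y : R) : Prop := exists k : int, x = y + k%:~R * (2 * pi).

Definition angle_pair g (t1 t2 : R) : Prop :=
  exists (u : U21 H) (P : 'M[C]_3) (a b c : R),
    [/\ lift_of g u,
        orthogonal_basis21 H P,
        [/\ val u *m col 0 P = expi a *: col 0 P,
            val u *m col 1 P = expi b *: col 1 P
          & val u *m col 2 P = expi c *: col 2 P]
      & (eq_mod2pi t1 (a - c) /\ eq_mod2pi t2 (b - c)) \/
        (eq_mod2pi t1 (b - c) /\ eq_mod2pi t2 (a - c))].

Definition is_involution g : Prop := g != 1%g /\ (g ^+ 2 = 1)%g.

Definition product_of_three_involutions g : Prop :=
  exists I1 I2 I3 : PU21 H,
    [/\ is_involution I1, is_involution I2, is_involution I3
      & g = (I1 * I2 * I3)%g].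

End Isometries.

(** Interior of the triangle: strictly positive barycentric coordinates. *)
Definition open_triangle (R : realType) (p q r : R * R) : set (R * R) :=
  [set x | exists a b c : R,
     [/\ 0 < a, 0 < b, 0 < c, a + b + c = 1
       & x = (a * p.1 + b * q.1 + c * r.1, a * p.2 + b * q.2 + c * r.2)]].

(* Main.v *)
Require Import Defs.
From mathcomp Require Import all_boot all_order all_algebra generic_quotient.
From mathcomp Require Import complex.
From mathcomp Require Import all_classical all_reals all_analysis.
From mathcomp Require Import ring lra.
Import Order.TTheory GRing.Theory Num.Theory.
Local Open Scope classical_set_scope.
Local Open Scope ring_scope.

(** An involution of PU(2,1) lifts, up to sign, to I_v = -1 + 2 P_v, where P_v
    is the orthogonal projection onto the line of a non-isotropic vector v
    ([unitary_involution_refl]), and det I_v = 1.  So E is a product of three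
    involutions iff one of its three lifts A of determinant 1 has the form
    I_v1 I_v2 I_v.  In an orthonormal eigenbasis whose last vector is the
    negative one, A = diag (e^(i a0), e^(i a1), e^(i a2)), where (a0, a1, a2) is
    ((2 t1 - t2) / 3, (2 t2 - t1) / 3, - (t1 + t2) / 3) shifted by 0 or
    by plus or minus 2 pi / 3, and (t1, t2) is the angle pair.

    Since E^-1 has the angle pair (2 pi - t2, 2 pi - t1), inversion exchanges
    T and T' ([three_involutions_mirror], [open_triangle_high]).  It is enough
    to treat t1 + t2 <= 2 pi; T' does not meet this half plane, and T is cut out
    by t2 < t1, pi < t1 + t2 and 2 t1 - t2 < pi.

    Obstruction in T ([triangle_not_three_involutions]).  Let A = I_v1 I_v2 I_v
    and let x <> 0 be orthogonal to v1 and v2.  Then I_v1 I_v2 fixes x, hence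
    A I_v x = x, and solving for x gives x_j = h (1 + i tan (a_j / 2)) v_j.
    The weights W_j = |v_j|^2 therefore satisfy
    W0 tan (a0 / 2) + W1 tan (a1 / 2) = W2 tan (a2 / 2)
    ([three_reflections_weights]).  Over T, for two of the three lifts the signs
    of the tangents forbid this.  For the third lift the relation forces x to be
    positive, so that the orthogonal complement of x, which contains v1 and v2,
    is indefinite and the ratio
    c = |<v1, v2>|^2 / (<v1, v1> <v2, v2>) is <= 0 or >= 1; but the trace of
    A I_v = I_v1 I_v2, which is 4 c - 1, gives 0 < c < 1
    ([weights_elliptic_absurd]).

    Existence outside T ([outside_triangle_three_involutions]).  If a
    transformation B of determinant 1 fixes a negative vector, its eigenvalues on
    the positive plane orthogonal to it are conjugate, and B is the product of
    the two I_w whose vectors w are sums of orthonormal eigenvectors of that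
    plane with suitable phases ([refl_mul_orthonormal]).  One looks for v
    orthogonal to a positive eigenvector of A such that B = A I_v is of this
    kind; such a v exists under an explicit inequality between sines of the
    arguments of the other two eigenvalues
    ([three_involutions_of_elliptic_angle]), which covers all (t1, t2) outside T
    except for the edge 2 t1 - t2 = pi.  There A has eigenvalue -1 on a positive
    eigenvector, and the three involutions are found among those preserving the
    complex line orthogonal to it ([three_involutions_in_complex_line]). *)

Set Implicit Arguments.
Unset Strict Implicit.
Unset Printing Implicit Defensive.

(** * Involutions of PU(2,1) and their lifts *)

Section Involutions.
Local Open Scope quotient_scope.
Context {R : realType}.
Local Notation C := R[i]%C.
Implicit Types (H A M P : 'M[C]_3) (c : C).

Lemma adjointK m n (A : 'M[C]_(m, n)) : adjoint (adjoint A) = A.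
Proof. by apply/matrixP => i j; rewrite !mxE conjCK. Qed.

Lemma adjointZ m n c (A : 'M[C]_(m, n)) : adjoint (c *: A) = c^* *: adjoint A.
Proof. by apply/matrixP => i j; rewrite !mxE rmorphM. Qed.

Lemma adjointD m n (A B : 'M[C]_(m, n)) : adjoint (A + B) = adjoint A + adjoint B.
Proof. by apply/matrixP => i j; rewrite !mxE rmorphD. Qed.

Lemma adjointN m n (A : 'M[C]_(m, n)) : adjoint (- A) = - adjoint A.
Proof. by apply/matrixP => i j; rewrite !mxE rmorphN. Qed.

(** The condition that M be non-scalar says that M does not act trivially on the
    projective plane. *)
Definition unitary_involution H M : Prop :=
  [/\ adjoint M *m H *m M = H, M *m M = 1%:M & forall c, M <> c%:M].

Definition three_involutions H A : Prop :=
  exists c J1 J2 J3, [/\ c != 0, unitary_involution H J1,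
    unitary_involution H J2, unitary_involution H J3
    & A = c *: (J1 *m J2 *m J3)].

Lemma preserves_form_involution H M : unitary_involution H M -> preserves_form H M.
Proof.
case=> hM M2 _; rewrite /preserves_form hM eqxx andbT.
by case/mulmx1_unit: M2.
Qed.

Lemma pi_eq1 H (u : U21 H) :
  \pi_(PU21 H) u = 1%g -> exists2 c, c != 0 & val u = c%:M.
Proof.
move=> e; have /eqP/PU21_eqP[c c0 ->] : \pi_(PU21 H) u = \pi_(PU21 H) 1%g by [].
by exists c => //; rewrite /= scalemx1.
Qed.

Lemma pi_scalar H (u : U21 H) c : val u = c%:M -> \pi_(PU21 H) u = 1%g.
Proof.
move=> e; apply/eqP; apply/PU21_eqP; exists c; last by rewrite e /= scalemx1.
apply: contraTneq (U21_unit u) => c0; rewrite e c0.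
by rewrite unitmxE det_scalar expr0n unitr0.
Qed.

(** If u lifts an involution then u^2 is a scalar c, and dividing u by a square
    root of c yields a lift of square 1.  The scalar c has modulus 1 because u^2
    preserves the nonzero form, so the rescaled lift is still unitary. *)
Lemma involution_lift H (g : PU21 H) : H != 0 ->
  is_involution g <-> exists2 u, lift_of g u & unitary_involution H (val u).
Proof.
move=> H0; split=> [[g1 g2]|[u <- [hu u2 un]]]; last first.
  split.
    by apply/eqP => /pi_eq1[c _ /un].
  rewrite expg2 -[LHS]/(PU21_mul _ _) PU21_piM; apply: (@pi_scalar _ _ 1).
  exact: u2.
have [u ug] : exists u, \pi_(PU21 H) u = g by exists (repr g); exact: reprK.
have [c c0 u2] : exists2 c, c != 0 & val u *m val u = c%:M.
  have /pi_eq1[c c0 e] : \pi_(PU21 H) (u * u)%g = 1%g.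
    by rewrite -g2 expg2 -ug -[RHS]/(PU21_mul _ _) PU21_piM.
  by exists c.
have /andP[uU /eqP uH] := valP u.
pose d := sqrtc c; have d2 : d ^+ 2 = c by exact: sqr_sqrtc.
have cc : c^* * c = 1.
  have : (c^* * c) *: H = 1 *: H.
    have e : adjoint (val u *m val u) *m H *m (val u *m val u) = H.
      by rewrite adjoint_mul !mulmxA -(mulmxA (adjoint _)) -(mulmxA (adjoint _)) uH uH.
    rewrite scale1r -{2}e u2 -scalemx1 adjointZ adjoint1.
    by rewrite -!scalemxAl -scalemxAr mul1mx mulmx1 scalerA.
  move=> /(congr1 (fun M => M - 1 *: H)) /eqP; rewrite -!scalerBl subrr scale0r.
  by rewrite scaler_eq0 (negPf H0) orbF subr_eq0 => /eqP.
have dd : d^* * d = 1.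
  have d0 : 0 <= d^* * d by rewrite mulrC mul_conjC_ge0.
  apply/eqP; rewrite -(@eqrXn2 _ 2) // expr1n exprMn -rmorphXn /= d2; exact/eqP.
have dn0 : d != 0 by apply/eqP => d0; move/eqP: cc; rewrite -d2 d0 expr0n mulr0 eq_sym oner_eq0.
have dV : (d^-1)^* * d^-1 = 1 by rewrite fmorphV -invfM dd invr1.
have MU : preserves_form H (d^-1 *: val u).
  rewrite /preserves_form unitmxZ ?unitfE ?invr_eq0 // uU adjointZ.
  by rewrite -!scalemxAl -scalemxAr uH scalerA dV scale1r eqxx.
exists (Sub _ MU).
  rewrite /lift_of -ug; apply/eqP/PU21_eqP; exists d^-1; rewrite ?invr_eq0 //.
split=> [||a].
- by have /andP[_ /eqP] := MU.
- rewrite SubK -scalemxAl -scalemxAr u2 scalerA -invfM -expr2 d2.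
  by rewrite -scalemx1 scalerA mulVf // scale1r.
- rewrite SubK => e; move: g1; rewrite -ug; apply/negP; rewrite negbK; apply/eqP.
  apply: (@pi_scalar _ _ (d * a)).
  by rewrite -scalemx1 -scalerA scalemx1 -e scalerA divff // scale1r.
Qed.

Lemma pi_mul3 H (u1 u2 u3 : U21 H) :
  (\pi_(PU21 H) u1 * \pi_(PU21 H) u2 * \pi_(PU21 H) u3)%g =
  \pi_(PU21 H) (u1 * u2 * u3)%g.
Proof. by rewrite -(PU21_piM (u1 * u2)%g u3) -(PU21_piM u1 u2). Qed.

(** Reduces the group-theoretic question to matrices; the scalar absorbed by
    [three_involutions] is the ambiguity of a lift. *)
Lemma product_of_three_involutionsP H (g : PU21 H) u : H != 0 -> lift_of g u ->
  product_of_three_involutions g <-> three_involutions H (val u).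
Proof.
move=> H0 ug; split.
  case=> I1 [I2 [I3 [/(involution_lift _ H0)[u1 <- h1] /(involution_lift _ H0)[u2 <- h2]]]].
  move=> /(involution_lift _ H0)[u3 <- h3].
  rewrite pi_mul3 -ug.
  move=> /eqP/PU21_eqP[c c0 e]; exists c, (val u1), (val u2), (val u3); split=> //.
case=> c [J1 [J2 [J3 [c0 h1 h2 h3 e]]]].
pose v1 : U21 H := Sub _ (preserves_form_involution h1).
pose v2 : U21 H := Sub _ (preserves_form_involution h2).
pose v3 : U21 H := Sub _ (preserves_form_involution h3).
exists (\pi v1), (\pi v2), (\pi v3); split.
- by apply/involution_lift => //; exists v1.
- by apply/involution_lift => //; exists v2.
- by apply/involution_lift => //; exists v3.
rewrite pi_mul3 -ug.
by apply/eqP/PU21_eqP; exists c.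
Qed.

Lemma unitary_involution_conj H P M : P \in unitmx ->
  unitary_involution H M ->
  unitary_involution (adjoint P *m H *m P) (invmx P *m M *m P).
Proof.
move=> uP [hM M2 Mn]; split=> [||c e].
- have aPK : adjoint P *m adjoint (invmx P) = 1%:M.
    by rewrite -adjoint_mul mulVmx // adjoint1.
  have aPK' : adjoint (invmx P) *m adjoint P = 1%:M.
    by rewrite -adjoint_mul mulmxV // adjoint1.
  rewrite !adjoint_mul -!mulmxA (mulKVmx uP).
  rewrite (mulmxA (adjoint (invmx P)) (adjoint P)) aPK' mul1mx.
  by rewrite (mulmxA H) (mulmxA (adjoint M)) (mulmxA (adjoint M)) hM.
- by rewrite -!mulmxA (mulKVmx uP) (mulmxA M) M2 mul1mx mulVmx.
- apply: (Mn c); have -> : M = P *m (invmx P *m M *m P) *m invmx P.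
    by rewrite !mulmxA mulmxV // mul1mx mulmxK.
  rewrite e.
  by rewrite mul_mx_scalar -scalemxAl mulmxV // scalemx1.
Qed.

Lemma three_involutions_conj H P A : P \in unitmx ->
  three_involutions H A ->
  three_involutions (adjoint P *m H *m P) (invmx P *m A *m P).
Proof.
move=> uP [c [J1 [J2 [J3 [c0 h1 h2 h3 ->]]]]].
exists c, (invmx P *m J1 *m P), (invmx P *m J2 *m P), (invmx P *m J3 *m P).
split=> //; try exact: unitary_involution_conj.
by rewrite -scalemxAr -scalemxAl !mulmxA !(mulmxK uP).
Qed.

(** Change of basis, under which the Gram matrix becomes P^* H P. *)
Lemma three_involutions_conjE H P A : P \in unitmx ->
  three_involutions H A <->
  three_involutions (adjoint P *m H *m P) (invmx P *m A *m P).
Proof.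
move=> uP; split; first exact: three_involutions_conj.
have uP' : invmx P \in unitmx by rewrite unitmx_inv.
move=> /(three_involutions_conj uP'); rewrite invmxK !mulmxA mulmxV // mul1mx (mulmxK uP).
rewrite (mulmxK uP) -(adjoint_mul P) mulmxV // adjoint1 mul1mx; exact.
Qed.

Lemma three_involutionsZ H A c : c != 0 ->
  three_involutions H (c *: A) <-> three_involutions H A.
Proof.
have imp B d : d != 0 -> three_involutions H B -> three_involutions H (d *: B).
  move=> d0 [k [J1 [J2 [J3 [k0 h1 h2 h3 ->]]]]].
  by exists (d * k), J1, J2, J3; split=> //; rewrite ?mulf_neq0 // scalerA.
move=> c0; split; last exact: imp.
by move=> /(imp _ c^-1); rewrite invr_eq0 scalerA mulVf // scale1r => /(_ c0).
Qed.

End Involutions.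

(** * Orthogonal reflections I_v *)

Section Reflections.
Context {R : realType}.
Local Notation C := R[i]%C.
Implicit Types (H A M P : 'M[C]_3) (v w x : 'cV[C]_3) (c : C).

(** The isometry I_v = -1 + 2 P_v: it fixes v and is -1 on its orthogonal
    complement.  Projectively it is the central symmetry about the point v when
    v is negative, and the reflection of order 2 in the complex line polar to v
    when v is positive. *)
Definition refl H v : 'M[C]_3 :=
  (2 / herm H v v) *: (v *m (adjoint v *m H)) - 1%:M.

Lemma herm_mx H v w : adjoint w *m H *m v = (herm H v w)%:M.
Proof. by rewrite [LHS]mx11_scalar. Qed.

Lemma adjointE m n (A : 'M[C]_(m, n)) i j : adjoint A i j = (A j i)^*.
Proof. by rewrite !mxE. Qed.

Lemma herm_conj H v w : adjoint H = H -> (herm H v w)^* = herm H w v.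
Proof.
move=> hH; have /matrixP/(_ 0 0) : adjoint (adjoint w *m H *m v) = adjoint v *m H *m w.
  by rewrite !adjoint_mul adjointK hH mulmxA.
by rewrite adjointE.
Qed.

Lemma refl_mul H v x :
  refl H v *m x = (2 * herm H x v / herm H v v) *: v - x.
Proof.
rewrite mulmxBl mul1mx -scalemxAl -mulmxA herm_mx mul_mx_scalar scalerA.
by congr (_ *: _ - _); rewrite mulrAC.
Qed.

Lemma refl_sqr H v : herm H v v != 0 -> refl H v *m refl H v = 1%:M.
Proof.
move=> n0; rewrite [X in _ *m X]/refl mulmxBr mulmx1 -scalemxAr (mulmxA _ v) refl_mul.
rewrite mulfK // scalerDl scale1r addrK.
by rewrite /refl opprB addrC subrK.
Qed.

Lemma rank1_projection n (P : 'M[C]_n) : P *m P = P -> \rank P = 1%N ->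
  exists (u : 'cV[C]_n) (phi : 'rV[C]_n), P = u *m phi /\ phi *m u = 1%:M.
Proof.
move=> PP rP; have := mulmx_base P.
have : row_free (row_base P) by exact: row_base_free.
have : row_full (col_base P) by exact: col_base_full.
move: (col_base P) (row_base P); rewrite rP => u phi fu fphi e.
exists u, phi; split=> //.
have : u *m (phi *m u) *m phi = u *m 1%:M *m phi by rewrite mulmx1 e !mulmxA e -mulmxA e PP.
by move/(row_free_inj fphi)/(row_full_inj fu).
Qed.

(** A projection of rank 1 is u phi with phi u = 1; self-adjointness for H
    forces phi to be proportional to u^* H, which makes it the orthogonal
    projection onto the line of u. *)
Lemma hermitian_projection_refl H P : adjoint H = H -> H \in unitmx ->
  adjoint P *m H = H *m P -> P *m P = P -> \rank P = 1%N ->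
  exists2 v, herm H v v != 0 & refl H v = 2 *: P - 1%:M.
Proof.
move=> hH uH hP PP rP; have [v [phi [e phiv]]] := rank1_projection PP rP.
have Hv : H *m v = herm H v v *: adjoint phi.
  rewrite -[LHS]mulmx1 -phiv mulmxA -(mulmxA H) -e -hP e adjoint_mul.
  by rewrite -!mulmxA (mulmxA (adjoint v)) herm_mx mul_mx_scalar.
have n0 : herm H v v != 0.
  apply/eqP => h0; move: Hv; rewrite h0 scale0r => /(congr1 (mulmx (invmx H))).
  rewrite mulKmx // mulmx0 => v0; move: phiv; rewrite v0 mulmx0 => /matrixP/(_ 0 0)/eqP.
  by rewrite !mxE eq_sym oner_eq0.
exists v => //; congr (_ - _); rewrite e.
have -> : adjoint v *m H = herm H v v *: phi.
  rewrite -[phi]adjointK -(herm_conj v v hH) -adjointZ -Hv adjoint_mul hH //.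
by rewrite -scalemxAr scalerA mulfVK.
Qed.

(** The eigenprojections (1 + M) / 2 and (1 - M) / 2 are complementary and both
    nonzero, so in dimension 3 one of them has rank 1. *)
Lemma unitary_involution_refl H M : adjoint H = H -> H \in unitmx ->
  unitary_involution H M ->
  exists2 v, herm H v v != 0 & M = refl H v \/ M = - refl H v.
Proof.
move=> hH uH [hM M2 Mn].
have HM : adjoint M *m H = H *m M by rewrite -{2}hM -!mulmxA M2 mulmx1.
pose P := 2^-1 *: (1%:M + M); pose Q := 2^-1 *: (1%:M - M).
have two0 : (2 : C) != 0 by rewrite pnatr_eq0.
have PQ1 : P + Q = 1%:M.
  rewrite -scalerDr addrACA subrr addr0 -(mulr2n 1%:M) -(scaler_nat 2 1%:M) scalerA mulVf //.
  by rewrite scale1r.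
have PQ : P *m Q = 0.
  rewrite -scalemxAl -scalemxAr mulmxDl !mulmxBr !mul1mx mulmx1 M2.
  by rewrite addrA subrK subrr !scaler0.
have MP : M = 2 *: P - 1%:M by rewrite scalerA divff // scale1r addrC addKr.
have MQ : M = - (2 *: Q - 1%:M).
  by rewrite scalerA divff // scale1r opprB subKr.
have PP : P *m P = P by rewrite -[in RHS](mulmx1 P) -PQ1 mulmxDr PQ addr0.
have QQ : Q *m Q = Q.
  by rewrite -[in RHS](mul1mx Q) -PQ1 mulmxDl PQ add0r.
have hN c (A B : 'M[C]_3) : c^* = c -> adjoint A *m H = H *m A ->
    adjoint (c *: (1%:M + A)) *m H = H *m (c *: (1%:M + A)).
  move=> cc hA; rewrite adjointZ cc adjointD adjoint1 -scalemxAl -scalemxAr.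
  by rewrite mulmxDl mulmxDr hA mul1mx mulmx1.
have c2 : (2^-1 : C)^* = 2^-1 by rewrite fmorphV rmorph_nat.
have P0 : P != 0.
  apply/eqP => P0; apply: (Mn (-1)).
  by rewrite MP P0 scaler0 sub0r raddfN.
have Q0 : Q != 0.
  apply/eqP => Q0; apply: (Mn 1).
  by rewrite MQ Q0 scaler0 sub0r opprK.
have [rP|rQ] : \rank P = 1%N \/ \rank Q = 1%N.
  have : (\rank P + \rank Q <= 3)%N by exact: mulmx0_rank_max.
  move: P0 Q0; rewrite -!mxrank_eq0.
  case: (\rank P) (\rank Q) => [|[|p]] [|[|q]] //; first by left.
  - by left.
  - by right.
  by rewrite !addSn !addnS.
- have [|v n0 e] := hermitian_projection_refl hH uH _ PP rP; first exact: hN.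
  by exists v => //; left; rewrite e.
have [|v n0 e] := hermitian_projection_refl hH uH _ QQ rQ.
  by apply: hN => //; rewrite adjointN mulNmx mulmxN HM.
by exists v => //; right; rewrite e.
Qed.

(** The trace of a product of two reflections only depends on the ratio
    |<v, w>|^2 / (<v, v> <w, w>), which tells whether v and w span a definite or
    an indefinite plane. *)
Lemma tr_refl2 H v w : adjoint H = H -> herm H v v != 0 -> herm H w w != 0 ->
  \tr (refl H v *m refl H w) =
  4 * (herm H v w * (herm H v w)^*) / (herm H v v * herm H w w) - 1.
Proof.
move=> hH nv nw.
have tr1 a b : \tr (a *m (adjoint b *m H)) = herm H a b.
  by rewrite mxtrace_mulC herm_mx /mxtrace big_ord1 mxE eqxx mulr1n.
rewrite /refl mulmxBl mul1mx mulmxBr mulmx1 -scalemxAl -scalemxAr scalerA.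
rewrite !raddfB /= !mxtraceZ mxtrace1 !tr1.
have -> : v *m (adjoint v *m H) *m (w *m (adjoint w *m H)) =
    herm H w v *: (v *m (adjoint w *m H)).
  by rewrite -mulmxA (mulmxA _ w) herm_mx mul_scalar_mx -scalemxAr.
rewrite mxtraceZ tr1 -(herm_conj v w hH).
by field; rewrite nv nw.
Qed.
End Reflections.

(** * Coordinates adapted to signature (2,1) *)

Section Coordinates.
Context {R : realType}.
Local Notation T := R[i]%C.
Implicit Types a b c d e f g h k x y z : T.

Definition mx3 (a b c d e f g h k : T) : 'M[T]_3 :=
  \matrix_(i, j) nth 0 (nth [::] [:: [:: a; b; c]; [:: d; e; f]; [:: g; h; k]] i) j.

Definition cv3 (a b c : T) : 'cV[T]_3 := \col_i nth 0 [:: a; b; c] i.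

Definition diag3 (a b c : T) : 'M[T]_3 := mx3 a 0 0 0 b 0 0 0 c.

Lemma ord3P (p : 'I_3 -> Prop) : p 0 -> p 1 -> p 2 -> forall i, p i.
Proof.
move=> p0 p1 p2 [[|[|[|//]]] h].
- by rewrite (_ : Ordinal h = 0) //; apply: val_inj.
- by rewrite (_ : Ordinal h = 1) //; apply: val_inj.
- by rewrite (_ : Ordinal h = 2) //; apply: val_inj.
Qed.

Lemma sum3 (V : nmodType) (F : 'I_3 -> V) : \sum_i F i = F 0 + F 1 + F 2.
Proof.
rewrite !big_ord_recl big_ord0 addr0 addrA.
by congr (F _ + F _ + F _); apply: val_inj.
Qed.

Lemma mx3_eta (A : 'M[T]_3) : A = mx3 (A 0 0) (A 0 1) (A 0 2)
  (A 1 0) (A 1 1) (A 1 2) (A 2 0) (A 2 1) (A 2 2).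
Proof. by apply/matrixP; apply: ord3P; apply: ord3P; rewrite mxE. Qed.

Lemma cv3_eta (v : 'cV[T]_3) : v = cv3 (v 0 0) (v 1 0) (v 2 0).
Proof. by apply/matrixP; apply: ord3P => j; rewrite (ord1 j) mxE. Qed.

Lemma mul_mx3 a b c d e f g h k (a' b' c' d' e' f' g' h' k' : T) :
  mx3 a b c d e f g h k *m mx3 a' b' c' d' e' f' g' h' k' =
  mx3 (a * a' + b * d' + c * g') (a * b' + b * e' + c * h') (a * c' + b * f' + c * k')
      (d * a' + e * d' + f * g') (d * b' + e * e' + f * h') (d * c' + e * f' + f * k')
      (g * a' + h * d' + k * g') (g * b' + h * e' + k * h') (g * c' + h * f' + k * k').
Proof.
by rewrite [LHS]mx3_eta; congr mx3; rewrite mxE sum3 !mxE.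
Qed.

Lemma mul_mx3_cv3 a b c d e f g h k x y z :
  mx3 a b c d e f g h k *m cv3 x y z =
  cv3 (a * x + b * y + c * z) (d * x + e * y + f * z) (g * x + h * y + k * z).
Proof.
by rewrite [LHS]cv3_eta; congr cv3; rewrite mxE sum3 !mxE.
Qed.

Lemma diag3_mul n a b c (M : 'M[T]_(3, n)) j :
  [/\ (diag3 a b c *m M) 0 j = a * M 0 j, (diag3 a b c *m M) 1 j = b * M 1 j
     & (diag3 a b c *m M) 2 j = c * M 2 j].
Proof.
by split; rewrite mxE sum3 !mxE /= !mul0r ?addr0 ?add0r.
Qed.

Lemma mul_diag3 a b c a' b' c' :
  diag3 a b c *m diag3 a' b' c' = diag3 (a * a') (b * b') (c * c').
Proof. by rewrite mul_mx3; congr mx3; ring. Qed.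

Lemma scale_mx3 a b c d e f g h k x : x *: mx3 a b c d e f g h k =
  mx3 (x * a) (x * b) (x * c) (x * d) (x * e) (x * f) (x * g) (x * h) (x * k).
Proof. by rewrite [LHS]mx3_eta; congr mx3; rewrite !mxE. Qed.

Lemma sub_mx3 a b c d e f g h k (a' b' c' d' e' f' g' h' k' : T) :
  mx3 a b c d e f g h k - mx3 a' b' c' d' e' f' g' h' k' =
  mx3 (a - a') (b - b') (c - c') (d - d') (e - e') (f - f') (g - g') (h - h') (k - k').
Proof. by rewrite [LHS]mx3_eta; congr mx3; rewrite !mxE. Qed.

Lemma scale_diag3 x a b c : x *: diag3 a b c = diag3 (x * a) (x * b) (x * c).
Proof. by rewrite scale_mx3; congr mx3; rewrite mulr0. Qed.

Lemma mx3_1 : 1%:M = mx3 1 0 0 0 1 0 0 0 1.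
Proof. by rewrite [LHS]mx3_eta; congr mx3; rewrite mxE. Qed.

Lemma det_mx2 (A : 'M[T]_2) : \det A = A 0 0 * A 1 1 - A 0 1 * A 1 0.
Proof.
rewrite (expand_det_row _ 0) !big_ord_recl big_ord0 /cofactor !det_mx11 !mxE.
rewrite (_ : lift ord0 ord0 = 1); last exact: val_inj.
rewrite (_ : lift 1 0 = 0); last exact: val_inj.
by rewrite /=; ring.
Qed.

Lemma det_mx3 a b c d e f g h k : \det (mx3 a b c d e f g h k) =
  a * (e * k - f * h) - b * (d * k - f * g) + c * (d * h - e * g).
Proof.
rewrite (expand_det_row _ 0) sum3 /cofactor !det_mx2 !mxE /=; ring.
Qed.
End Coordinates.

Section Form21.
Context {R : realType}.
Local Notation C := R[i]%C.
Implicit Types (l m b p q : C) (v w : 'cV[C]_3).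

Definition form21 : 'M[C]_3 := diag3 1 1 (-1).

Lemma adjoint_mx3 (a b c d e f g h k : C) : adjoint (mx3 a b c d e f g h k) =
  mx3 a^* d^* g^* b^* e^* h^* c^* f^* k^*.
Proof. by rewrite [LHS]mx3_eta; congr mx3; rewrite adjointE mxE. Qed.

Lemma form21_herm : adjoint form21 = form21.
Proof. by rewrite adjoint_mx3 rmorphN !rmorph1 !rmorph0. Qed.

Lemma form21_unit : form21 \in unitmx.
Proof.
rewrite unitmxE det_mx3 unitfE !(mul1r, mulr0, mul0r, subr0, addr0).
by rewrite oppr_eq0 oner_eq0.
Qed.

Lemma herm_form21 v w :
  herm form21 v w = v 0 0 * (w 0 0)^* + v 1 0 * (w 1 0)^* - v 2 0 * (w 2 0)^*.
Proof.
rewrite /herm -mulmxA (cv3_eta v) mul_mx3_cv3 mxE sum3 !adjointE !mxE /=.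
by ring.
Qed.

Lemma refl_involution (H : 'M[C]_3) v : adjoint H = H -> herm H v v != 0 ->
  unitary_involution H (refl H v).
Proof.
move=> hH n0; split=> [||c e]; last 2 first.
- exact: refl_sqr.
- have v0 : v != 0 by apply: contraNneq n0 => ->; rewrite /herm mulmx0 mxE.
  have /eqP : refl H v *m v = v.
    by rewrite refl_mul mulfK // scaler_nat mulr2n addrK.
  rewrite e mul_scalar_mx -subr_eq0 -[X in _ - X]scale1r -scalerBl scaler_eq0.
  rewrite (negPf v0) orbF subr_eq0 => /eqP c1.
  move/(congr1 mxtrace): e; rewrite c1 mxtrace1 /refl raddfB /= mxtraceZ mxtrace1.
  rewrite mxtrace_mulC herm_mx /mxtrace big_ord1 mxE eqxx mulr1n.
  rewrite mulfVK // => /eqP; rewrite -subr_eq0 -[X in X == _]opprK oppr_eq0.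
  by rewrite (_ : - _ = 4%:R) ?pnatr_eq0 //; ring.
have e : adjoint (refl H v) *m H = H *m refl H v.
  rewrite /refl adjointD adjointN adjoint1 adjointZ !adjoint_mul adjointK hH.
  rewrite mulmxBl mulmxBr mul1mx mulmx1 -scalemxAl -scalemxAr !mulmxA.
  by rewrite rmorphM fmorphV rmorph_nat /= herm_conj.
by rewrite e -mulmxA refl_sqr // mulmx1.
Qed.

(** A transformation acting on an orthonormal pair (e, f) by the conjugate phases
    - nu and - nu^* and trivially on its orthogonal complement is a product of two
    reflections: the reflection in e + f exchanges e and f, and the reflection in
    e - nu' f exchanges them back with the required phases. *)
Lemma refl_mul_orthonormal (H : 'M[C]_3) e f (nu nu' : C) : adjoint H = H ->
  herm H e e = 1 -> herm H f f = 1 -> herm H e f = 0 -> nu^* = nu' -> nu * nu' = 1 ->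
  exists v w, [/\ herm H v v != 0, herm H w w != 0 &
   refl H v *m refl H w = 1%:M - (1 + nu) *: (e *m (adjoint e *m H))
                               - (1 + nu') *: (f *m (adjoint f *m H))].
Proof.
move=> hH ee ff ef nuE nn.
have nu'E : nu'^* = nu by rewrite -nuE conjCK.
have fe : herm H f e = 0 by rewrite -herm_conj // ef rmorph0.
have hD (a b : 'cV[C]_3) (c d : C) : herm H (a + c *: b) (a + d *: b) =
    herm H a a + c * herm H b a + d^* * (herm H a b + c * herm H b b).
  rewrite /herm adjointD adjointZ !mulmxDl !mulmxDr -!scalemxAl -!scalemxAr.
  by rewrite !mxE; ring.
have two0 : (2 : C) != 0 by rewrite pnatr_eq0.
have hv : herm H (e + (- nu') *: f) (e + (- nu') *: f) = 2.
  rewrite hD ee ff ef fe rmorphN /= nu'E; ring: nn.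
have hw : herm H (e + f) (e + f) = 2.
  have := hD e f 1 1; rewrite !scale1r => ->.
  by rewrite ee ff ef fe rmorph1; ring.
have hwv : herm H (e + f) (e + (- nu') *: f) = 1 - nu.
  have := hD e f 1 (- nu'); rewrite !scale1r => ->.
  by rewrite ee ff ef fe rmorphN /= nu'E; ring.
exists (e + (- nu') *: f), (e + f); rewrite hv hw; split => //.
rewrite [X in _ *m X = _]/refl hw divff // scale1r mulmxBr mulmx1.
rewrite (mulmxA (refl _ _)) refl_mul hv hwv mulrAC divff // mul1r.
rewrite /refl hv divff // scale1r !adjointD !adjointZ rmorphN /= nu'E.
set a := adjoint e; set b := adjoint f.
apply/matrixP => i j; rewrite !mulmxDl -!scalemxAl.
set aH := a *m H; set bH := b *m H.
rewrite !(mxE, big_ord1); ring: nn.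
Qed.

End Form21.

(** * Explicit products of three involutions *)

Section Constructions.
Context {R : realType}.
Local Notation C := R[i]%C.
Implicit Types (l m b p q : C).

(** The involution acting as -1 on the second basis vector, and as the half-turn
    of trace 0 with entries r and b on the indefinite plane spanned by the other
    two. *)
Definition plane_involution (r b : C) : 'M[C]_3 :=
  mx3 r 0 b 0 (-1) 0 (- b^*) 0 (- r).

Lemma plane_involutionP (r b : C) : r^* = r -> r * r = 1 + b * b^* ->
  unitary_involution form21 (plane_involution r b).
Proof.
move=> rr rb; have bb : b * b^* = r * r - 1 by rewrite rb addrC addKr.
split=> [||c].
- rewrite adjoint_mx3 !mul_mx3 !rmorphN /= conjCK !rmorph0 rmorph1 rr.
  by congr mx3; ring: bb.
- by rewrite mul_mx3 mx3_1; congr mx3; ring: bb.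
rewrite -[c%:M]scalemx1 mx3_1 => /matrixP e.
have := e 0 0; have := e 1 1; have := e 2 2; rewrite !mxE /= !mulr1 => e2 e1 e0.
have r1 : r = -1 by rewrite e0 -e1.
move/eqP: e2; rewrite -e1 r1 opprK -subr_eq0 opprK.
by rewrite (pnatr_eq0 C 2).
Qed.

Lemma diag3_plane_involution (a c d r b : C) :
  diag3 a c d *m plane_involution r b =
  mx3 (a * r) 0 (a * b) 0 (- c) 0 (- (d * b^*)) 0 (- (d * r)).
Proof. by rewrite mul_mx3; congr mx3; ring. Qed.

Lemma cv3_mul_adjoint (a b c : C) :
  cv3 a b c *m (adjoint (cv3 a b c) *m form21) =
  mx3 (a * a^*) (a * b^*) (- (a * c^*)) (b * a^*) (b * b^*) (- (b * c^*))
      (c * a^*) (c * b^*) (- (c * c^*)).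
Proof.
rewrite mulmxA [LHS]mx3_eta.
by congr mx3; rewrite mxE sum3 !mxE !big_ord1 !adjointE !mxE /=; ring.
Qed.

(** With J = [plane_involution r b], the determinant of A J on the plane
    spanned by the first and third basis vectors is - l m.  The equation
    r (l - m) = 1 - l m says that its trace there is 1 - l m, so that its
    eigenvalues are 1 and - l m; the eigenvector for 1 is negative because
    n^2 = 2 - 2 r Re l is positive, and f below is the unit eigenvector for - l m.
    On the second basis vector A J is - (l m)^*, so [refl_mul_orthonormal]
    applies to that vector and f. *)
Lemma three_involutions_of_elliptic_alg (l m r b n : C) :
  l * l^* = 1 -> m * m^* = 1 -> r^* = r -> b^* = b -> n^* = n -> n != 0 ->
  r * (l - m) = 1 - l * m -> b * b = r * r - 1 -> n * n = 2 - r * (l + l^*) ->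
  three_involutions form21 (diag3 l (l * m)^* m).
Proof.
move=> ll mm rr bb nn n0 rlm b2 n2.
have nunu : (l * m)^* * (l * m) = 1 by rewrite rmorphM /=; ring: ll mm.
have rlm' : r * l = 1 - l * m + r * m by rewrite -rlm; ring.
have aux : l^* - r = m * (1 - l^* * r).
  apply/eqP; rewrite -subr_eq0; apply/eqP.
  transitivity (l^* * (1 - l * m) - l^* * (r * (l - m))); first by ring: ll.
  by rewrite rlm subrr.
have aux2 : r * r - 1 = - (1 + m * r) * (1 - l^* * r).
  have -> : - (1 + m * r) * (1 - l^* * r) =
    - (1 - l^* * r) - r * (m * (1 - l^* * r)) by ring.
  by rewrite -aux; ring.
have key : (1 + l * m) * (1 - l^* * r) = n * n.
  by rewrite n2 (mulrDr r) rlm'; ring: ll.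
have [f0 [f2 [f0E f2E f0c f2c]]] : exists f0 f2 : C,
    [/\ f0 = (1 - l^* * r) / n, f2 = l^* * b / n,
        f0^* = (1 - l * r) / n & f2^* = l * b / n].
  exists ((1 - l^* * r) / n), (l^* * b / n); split=> //.
    by rewrite rmorphM fmorphV rmorphB rmorph1 rmorphM /= conjCK nn rr.
  by rewrite rmorphM fmorphV rmorphM /= conjCK nn bb.
have ee : herm form21 (cv3 0 1 0) (cv3 0 1 0) = 1 :> C.
  by rewrite herm_form21 !mxE /= rmorph0 rmorph1; ring.
have ef : herm form21 (cv3 0 1 0) (cv3 f0 0 f2) = 0 :> C.
  by rewrite herm_form21 !mxE /= rmorph0; ring.
have ff : herm form21 (cv3 f0 0 f2) (cv3 f0 0 f2) = 1 :> C.
  rewrite herm_form21 !mxE /= f0c f2c rmorph0 mulr0 addr0 f0E f2E.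
  rewrite !mulf_div -mulrBl -[RHS](@divff _ (n * n)) ?mulf_neq0 //.
  by congr (_ / _); rewrite n2; ring: ll b2.
have [v [w [v0 w0 vw]]] := refl_mul_orthonormal form21_herm ee ff ef (conjCK (l * m)) nunu.
have J3 : unitary_involution form21 (plane_involution r b).
  by apply: plane_involutionP => //; rewrite bb b2; ring.
exists 1, (refl form21 v), (refl form21 w), (plane_involution r b); split=> //.
- exact: refl_involution form21_herm v0.
- exact: refl_involution form21_herm w0.
rewrite scale1r; have [_ J3J3 _] := J3.
rewrite -[LHS]mulmx1 -J3J3 mulmxA; congr (_ *m _).
rewrite diag3_plane_involution bb vw !cv3_mul_adjoint mx3_1 !scale_mx3 !sub_mx3.
have K : (1 + l * m) * (1 - l^* * r) * (n^-1 * n^-1) = 1.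
  by rewrite key mulrACA divff // mulr1.
have K1 : (1 + l * m) * (f0 * f0^*) = 1 - l * r.
  by rewrite f0c -[RHS]mul1r -[X in _ = X * _]K f0E; ring.
have K2 : (1 + l * m) * (f0 * f2^*) = l * b.
  by rewrite f2c -[RHS]mul1r -[X in _ = X * _]K f0E; ring.
have K3 : (1 + l * m) * (f2 * f0^*) = m * b.
  rewrite f0c -[RHS]mul1r -[X in _ = X * _]K f2E.
  have -> : (1 + l * m) * (1 - l^* * r) * (n^-1 * n^-1) * (m * b) =
     (1 + l * m) * (m * (1 - l^* * r)) * (n^-1 * n^-1) * b by ring.
  by rewrite -aux; ring: ll.
have K4 : (1 + l * m) * (f2 * f2^*) = - (1 + m * r).
  rewrite f2c -[RHS]mul1r -[X in _ = X * _]K f2E.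
  have -> : (1 + l * m) * (1 - l^* * r) * (n^-1 * n^-1) * - (1 + m * r) =
     (1 + l * m) * (- (1 + m * r) * (1 - l^* * r)) * (n^-1 * n^-1) by ring.
  by rewrite -aux2; ring: ll b2.
congr mx3; rewrite ?mulrN ?K1 ?K2 ?K3 ?K4 ?rmorph0 ?rmorph1; ring.
Qed.

Lemma three_involutions_of_elliptic (l m : C) (r : R) :
  l * l^* = 1 -> m * m^* = 1 -> (r%:C)%C * (l - m) = 1 - l * m ->
  1 <= r ^+ 2 -> r * complex.Re l < 1 ->
  three_involutions form21 (diag3 l (l * m)^* m).
Proof.
move=> ll mm rlm r1 rl.
have N0 : 0 < 2 - 2 * (r * complex.Re l) by lra.
apply: (@three_involutions_of_elliptic_alg l m (r%:C)%C ((Num.sqrt (r ^+ 2 - 1))%:C)%C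
  ((Num.sqrt (2 - 2 * (r * complex.Re l)))%:C)%C) => //; try exact: conjc_real.
- by rewrite fmorph_eq0 sqrtr_eq0 -ltNge.
- rewrite -!rmorphM -expr2 sqr_sqrtr ?subr_ge0 //.
  by rewrite rmorphB /= rmorph1 expr2.
- rewrite -rmorphM -expr2 sqr_sqrtr ?ltW //.
  have -> : l + l^* = ((2 * complex.Re l)%:C)%C by rewrite addcJ rmorphM /= rmorph_nat.
  by rewrite -rmorphM rmorphB /= rmorph_nat; congr (_ - (_%:C)%C); ring.
Qed.

(** Here l = c + i s has modulus 1.  With A = diag (l, -1, - l^* ) and J of
    parameters m and b = p t, a third involution K is sought such that A J K is
    again an involution of this type.  This amounts to one real linear condition
    on the entries p and q of K, solved by q = - i rho l.  The normalization
    m c = 2 makes the trace 2 m c = 4 of A J on the complex line hyperbolic; any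
    value larger than 2 would do, and 3 = t^2 is (m c)^2 - 1. *)
Lemma three_involutions_in_complex_line_alg (i c s m p rho t : C) :
  i * i = -1 -> i^* = - i -> c^* = c -> s^* = s -> m^* = m -> p^* = p ->
  rho^* = rho -> t^* = t -> c * c + s * s = 1 -> t * t = 3 ->
  m * c = 2 -> s * m = rho * t -> p * p = 1 + rho * rho ->
  three_involutions form21 (diag3 (c + i * s) (-1) (- (c - i * s))).
Proof.
move=> ii ic cc sc mc pc rc tc cs tt mc2 smr pp.
have [l lE] : exists l : C, l = c + i * s by eexists.
have [l' l'E] : exists l' : C, l' = c - i * s by eexists.
have lc : l^* = l' by rewrite lE l'E rmorphD rmorphM /= ic cc sc mulNr.
have ll : l * l' = 1 by rewrite lE l'E -[RHS]cs; ring: ii.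
have mm : m * m = 4 + 3 * (rho * rho).
  transitivity (m * m * (c * c + s * s)); first by rewrite cs mulr1.
  transitivity ((m * c) * (m * c) + (s * m) * (s * m)); first by ring.
  by rewrite mc2 smr; ring: tt.
have [b bE] : exists b : C, b = p * t by eexists.
have [q qE] : exists q : C, q = - (i * rho * l) by eexists.
have bc : b^* = b by rewrite bE rmorphM /= pc tc.
have bb : b * b = m * m - 1 by rewrite mm bE; ring: tt pp.
have qc : q^* = i * rho * l' by rewrite qE rmorphN !rmorphM /= ic rc lc; ring.
have qq : q * q^* = rho * rho by rewrite qc qE; ring: ll ii.
have [a aE] : exists a : C, a = l * (m * q - b * p) by eexists.
have ac : a^* = l' * (m * q^* - b * p).
  by rewrite aE rmorphM rmorphB !rmorphM /= lc mc bc pc.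
have aa : a * a^* = 4 * (p * p) - 1.
  rewrite ac aE.
  transitivity (l * l' * (m * m * (q * q^*) + b * b * (p * p) - m * b * p * (q + q^*))).
    by ring.
  have -> : m * b * p * (q + q^*) = 6 * (p * p * (rho * rho)).
    rewrite qc qE bE lE l'E.
    transitivity (- 2 * (i * i) * p * p * t * rho * (s * m)); first by ring.
    by rewrite smr ii; ring: tt.
  by rewrite ll qq bb mm pp; ring.
have J3 : unitary_involution form21 (plane_involution m b).
  by apply: plane_involutionP => //; rewrite bc bb; ring.
have J2 : unitary_involution form21 (plane_involution p q).
  by apply: plane_involutionP => //; rewrite qq.
have J1 : unitary_involution form21 (plane_involution (2 * p) a).
  by apply: plane_involutionP; rewrite ?rmorphM ?rmorph_nat /= ?pc ?aa //; ring.
exists 1, (plane_involution (2 * p) a), (plane_involution p q), (plane_involution m b).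
split=> //; rewrite scale1r -lE -l'E.
have [_ J33 _] := J3; have [_ J22 _] := J2.
have lmp : l * m - i * rho * t = 2.
  by rewrite -mulrA -smr lE -mc2; ring.
have lmp' : l' * m + i * rho * t = 2.
  by rewrite -[i * rho * t]mulrA -smr l'E -mc2; ring.
suff : diag3 l (-1) (- l') *m plane_involution m b *m plane_involution p q =
  plane_involution (2 * p) a.
  by move=> <-; rewrite -(mulmxA _ (plane_involution p q) (plane_involution p q)) J22 mulmx1 -mulmxA J33 mulmx1.
rewrite diag3_plane_involution /plane_involution mul_mx3 ac bc.
congr mx3; rewrite ?aE ?qc ?bE ?qE; try ring.
  by rewrite -lmp; ring: ll.
by rewrite -lmp'; ring: ll.
Qed.

Lemma expiD (x y : R) : expi (x + y) = expi x * expi y.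
Proof. by apply/eqP; rewrite eq_complex /= cosD sinD addrC [X in _ && (_ == X)]addrC !eqxx. Qed.

Lemma expi_conj (x : R) : (expi x)^* = expi (- x).
Proof. by apply/eqP; rewrite eq_complex /= cosN sinN !eqxx. Qed.

Lemma expi0 : expi (0 : R) = 1.
Proof. by rewrite /expi cos0 sin0. Qed.

Lemma expi_mul_conj (x : R) : expi x * (expi x)^* = 1.
Proof. by rewrite expi_conj -expiD subrr expi0. Qed.

Lemma expi_neq0 (x : R) : expi x != 0.
Proof.
by apply: contraTneq (oner_neq0 C) => x0; rewrite -(expi_mul_conj x) x0 mul0r eqxx.
Qed.

Lemma three_involutions_in_complex_line (x : R) : cos x != 0 ->
  three_involutions form21 (diag3 (expi x) (-1) (- expi (- x))).
Proof.
move=> c0.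
have e1 : expi x = (cos x)%:C%C + 'i%C * (sin x)%:C%C by rewrite [LHS]complexE.
have e2 : expi (- x) = (cos x)%:C%C - 'i%C * (sin x)%:C%C.
  by rewrite [LHS]complexE /= cosN sinN rmorphN mulrN.
rewrite e1 e2.
pose m := 2 / cos x; pose t : R := Num.sqrt 3; pose rho := sin x * m / t.
have t2 : t * t = 3 by rewrite -expr2 sqr_sqrtr.
have t0 : t != 0 by rewrite sqrtr_eq0 -ltNge.
apply: (@three_involutions_in_complex_line_alg 'i%C (cos x)%:C%C (sin x)%:C%C m%:C%C
  (Num.sqrt (1 + rho * rho))%:C%C rho%:C%C t%:C%C); try exact: conjc_real.
- by rewrite -expr2 sqr_i.
- by apply/eqP; rewrite eq_complex /= oppr0 !eqxx.
- by rewrite -!rmorphM -rmorphD -!expr2 /= cos2Dsin2 rmorph1.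
- by rewrite -rmorphM t2 rmorph_nat.
- by rewrite -rmorphM /m mulfVK // rmorph_nat.
- by rewrite -!rmorphM /rho mulfVK.
- rewrite -!rmorphM -expr2 sqr_sqrtr ?rmorphD ?rmorph1 //.
  by rewrite addr_ge0 // -expr2 sqr_ge0.
Qed.

(** For l = e^(i x) and m = e^(i y) the parameter r of
    [three_involutions_of_elliptic] is - sin ((x + y) / 2) / sin ((x - y) / 2).
    The first inequality is 1 <= r^2, because
    r^2 - 1 = sin x sin y / sin^2 ((x - y) / 2); the second one is r cos x < 1. *)
Lemma three_involutions_of_elliptic_angle (x y : R) :
  0 <= sin x * sin y -> 0 < cos ((x + y) / 2) * sin ((x - y) / 2) * sin x ->
  three_involutions form21 (diag3 (expi x) (expi (- (x + y))) (expi y)).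
Proof.
move=> sxy csx; rewrite -expi_conj expiD.
set u := (x + y) / 2 in csx *; set d := (x - y) / 2 in csx *.
have xE : x = u + d by rewrite /u /d; field.
have yE : y = u - d by rewrite /u /d; field.
have d0 : sin d != 0 by apply: contraTneq csx => ->; rewrite mulr0 mul0r ltxx.
have u2 := cos2Dsin2 u; have d2 := cos2Dsin2 d.
pose r := - (sin u / sin d).
have rd : r * sin d = - sin u by rewrite /r mulNr mulfVK.
have sd : 0 < sin d ^+ 2 by rewrite exprn_even_gt0.
apply: (@three_involutions_of_elliptic _ _ r); try exact: expi_mul_conj.
- apply/eqP; rewrite eq_complex /= -cosD [X in 0 - X]addrC -sinD.
  have -> : x + y = u + u by rewrite /u; field.
  rewrite xE yE !cosD !sinD cosN sinN !mul0r subr0 addr0.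
  apply/andP; split; apply/eqP.
    transitivity (- 2 * (r * sin d) * sin u); first by ring.
    by rewrite rd -[X in _ = X - _]u2; ring.
  transitivity (2 * (r * sin d) * cos u); first by ring.
  by rewrite rd; ring.
- rewrite -(ler_pM2r sd) mul1r -exprMn rd sqrrN -subr_ge0.
  have <- // : sin x * sin y = sin u ^+ 2 - sin d ^+ 2.
  by rewrite xE yE !sinD cosN sinN; nra.
- rewrite -(ltr_pM2r sd) mul1r -subr_gt0 /=.
  have <- // : cos u * sin d * sin x = sin d ^+ 2 - r * cos x * sin d ^+ 2.
  have -> : r * cos x * sin d ^+ 2 = (r * sin d) * cos x * sin d by ring.
  by rewrite rd xE sinD cosD; nra.
Qed.

End Constructions.

(** * Constraints on a product of three reflections *)

Section Necessity.
Context {R : realType}.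
Local Notation C := R[i]%C.
Implicit Types (v w x : 'cV[C]_3).

Lemma refl_orthogonal (H : 'M[C]_3) v x : herm H x v = 0 -> refl H v *m x = - x.
Proof. by move=> xv; rewrite refl_mul xv mulr0 mul0r scale0r sub0r. Qed.

Lemma det_refl (H : 'M[C]_3) v : herm H v v != 0 -> \det (refl H v) = 1.
Proof.
move=> n0.
have : adjoint v *m H *m v = (herm H v v)%:M by exact: herm_mx.
rewrite /refl; set phi := adjoint v *m H; set n := herm H v v in n0 * => e.
have {}e : phi 0 0 * v 0 0 + phi 0 1 * v 1 0 + phi 0 2 * v 2 0 = n.
  by move/matrixP/(_ 0 0): e; rewrite mxE sum3 [RHS]mxE eqxx mulr1n.
rewrite [X in \det X]mx3_eta det_mx3 !mxE !big_ord1 /=.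
transitivity (2 / n * (phi 0 0 * v 0 0 + phi 0 1 * v 1 0 + phi 0 2 * v 2 0) - 1).
  by ring.
by rewrite e mulfVK //; ring.
Qed.

Definition normsq (z : C) : R := complex.Re z ^+ 2 + complex.Im z ^+ 2.

Lemma normsq_ge0 z : 0 <= normsq z.
Proof. by rewrite addr_ge0 // sqr_ge0. Qed.

Lemma normsqE z : z * z^* = (normsq z)%:C%C.
Proof.
case: z => a b; apply/eqP; rewrite eq_complex /normsq /=.
by apply/andP; split; apply/eqP; ring.
Qed.

(** The Cayley transform: 1 + e^(- i a) is inverted by (1 + i tan (a / 2)) / 2. *)
Lemma expi_half_tan (a : R) : cos (a / 2) != 0 ->
  (1 + expi (- a)) * (1 + 'i%C * (tan (a / 2))%:C%C) = 2 :> C.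
Proof.
move=> c0; have e : a = a / 2 + a / 2 by field.
have s2 := cos2Dsin2 (a / 2).
rewrite /tan; set u := a / 2 in e c0 s2 *; rewrite {}e.
apply/eqP; rewrite eq_complex /= cosN sinN cosD sinD.
apply/andP; split; apply/eqP.
  transitivity (1 + (cos u ^+ 2 + sin u ^+ 2)); first by field.
  by rewrite s2.
transitivity ((1 - (cos u ^+ 2 + sin u ^+ 2)) * (sin u / cos u)); first by field.
by rewrite s2; ring.
Qed.

Lemma orthogonal_pair (H : 'M[C]_3) v w :
  exists2 x, x != 0 & herm H x v = 0 /\ herm H x w = 0.
Proof.
pose M := col_mx (adjoint v *m H) (adjoint w *m H).
have : kermx M^T != 0.
  rewrite -mxrank_eq0 mxrank_ker mxrank_tr -lt0n subn_gt0.
  by rewrite (leq_ltn_trans (rank_leq_row M)).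
case/rowV0Pn => y /sub_kermxP yM y0; exists y^T; first by rewrite trmx_eq0.
have /(congr1 trmx) : y *m M^T = 0 by [].
rewrite trmx_mul trmxK trmx0 mul_col_mx => /eqP; rewrite col_mx_eq0.
by case/andP=> /eqP e1 /eqP e2; rewrite /herm e1 e2 mxE.
Qed.

Lemma herm_normsq v : herm form21 v v =
  (normsq (v 0 0) + normsq (v 1 0) - normsq (v 2 0))%:C%C.
Proof. by rewrite herm_form21 !normsqE -rmorphD -rmorphB. Qed.

(** The Gram determinant of (v, w, x) is - |det|^2 in signature (2,1).  In
    particular v and w span an indefinite or degenerate plane when x is
    positive. *)
Lemma gram_det_le0 v w x : herm form21 x v = 0 -> herm form21 x w = 0 ->
  complex.Re (herm form21 x x) *
  (complex.Re (herm form21 v v) * complex.Re (herm form21 w w)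
   - normsq (herm form21 v w)) <= 0.
Proof.
move=> xv xw.
have vx : herm form21 v x = 0 by rewrite -(herm_conj _ _ form21_herm) xv rmorph0.
have wx : herm form21 w x = 0 by rewrite -(herm_conj _ _ form21_herm) xw rmorph0.
pose Q := mx3 (v 0 0) (w 0 0) (x 0 0) (v 1 0) (w 1 0) (x 1 0) (v 2 0) (w 2 0) (x 2 0).
have : adjoint Q *m form21 *m Q =
    mx3 (herm form21 v v) (herm form21 w v) (herm form21 x v)
        (herm form21 v w) (herm form21 w w) (herm form21 x w)
        (herm form21 v x) (herm form21 w x) (herm form21 x x).
  by rewrite adjoint_mx3 /form21 /diag3 !mul_mx3; congr mx3; rewrite herm_form21; ring.
rewrite xv xw vx wx => e.
have := congr1 determinant e; rewrite !det_mulmx /adjoint det_map_mx det_tr.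
rewrite (det_mx3 1) [X in _ = X]det_mx3 -(herm_conj v w form21_herm).
have -> : (\det Q)^* * (1 * (1 * -1 - 0 * 0) - 0 * (0 * -1 - 0 * 0) +
   0 * (0 * 0 - 1 * 0)) * \det Q = - (normsq (\det Q))%:C%C.
  by rewrite -normsqE; ring.
rewrite !herm_normsq /=; move: (herm form21 v w) => g.
move: (_ (v 0 0) + _ - _) (_ (w 0 0) + _ - _) (_ (x 0 0) + _ - _) => a b c.
have -> : a%:C%C * (b%:C%C * c%:C%C - 0 * 0) - g^* * (g * c%:C%C - 0 * 0) +
    0 * (g * 0 - b%:C%C * 0) = (c * (a * b - normsq g))%:C%C.
  by rewrite rmorphM /= rmorphB /= rmorphM /= -normsqE; ring.
rewrite -rmorphN => /complexI <-.
by rewrite oppr_le0 normsq_ge0.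
Qed.

(** Moving M3 to the left-hand side turns a factorization into a statement on the
    vector x, on which M1 and M2 both act as -1. *)
Lemma fixed_vector (A M1 M2 M3 : 'M[C]_3) x :
  A = M1 *m M2 *m M3 -> M3 *m M3 = 1%:M -> M1 *m x = - x -> M2 *m x = - x ->
  A *m M3 = M1 *m M2 /\ A *m (M3 *m x) = x.
Proof.
move=> -> M33 M1x M2x; rewrite -(mulmxA _ M3 M3) M33 mulmx1; split=> //.
rewrite mulmxA -(mulmxA _ M3 M3) M33 mulmx1 -mulmxA M2x mulmxN M1x.
exact: opprK.
Qed.

Lemma fixed_vector_diag3 (a0 a1 a2 : R) v x (k : C) :
  cos (a0 / 2) != 0 -> cos (a1 / 2) != 0 -> cos (a2 / 2) != 0 ->
  diag3 (expi a0) (expi a1) (expi a2) *m (k *: v - x) = x ->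
  [/\ x 0 0 = k / 2 * (1 + 'i%C * (tan (a0 / 2))%:C%C) * v 0 0,
      x 1 0 = k / 2 * (1 + 'i%C * (tan (a1 / 2))%:C%C) * v 1 0
    & x 2 0 = k / 2 * (1 + 'i%C * (tan (a2 / 2))%:C%C) * v 2 0].
Proof.
move=> c0 c1 c2 e.
have xE i a : cos (a / 2) != 0 -> x i 0 = expi a * (k *: v - x) i 0 ->
    x i 0 = k / 2 * (1 + 'i%C * (tan (a / 2))%:C%C) * v i 0.
  move=> ca; rewrite !mxE => xi.
  have {}xi : (1 + expi (- a)) * x i 0 = k * v i 0.
    have ea : expi (- a) * expi a = 1 :> C by rewrite -expiD addNr expi0.
    rewrite mulrDl mul1r {2}xi mulrA ea mul1r; ring.
  have two0 : (2 : C) != 0 by rewrite pnatr_eq0.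
  apply: (mulfI two0).
  transitivity ((1 + expi (- a)) * x i 0 * (1 + 'i%C * (tan (a / 2))%:C%C)).
    by rewrite -{1}(expi_half_tan ca); ring.
  by rewrite xi; field.
have [d0 d1 d2] := diag3_mul (expi a0) (expi a1) (expi a2) (k *: v - x) 0.
rewrite e in d0 d1 d2.
by split; apply: xE.
Qed.

Lemma refl_diagonal v (n := herm form21 v v) : n != 0 ->
  [/\ refl form21 v 0 0 * n = 2 * (v 0 0 * (v 0 0)^*) - n,
      refl form21 v 1 1 * n = 2 * (v 1 0 * (v 1 0)^*) - n
    & refl form21 v 2 2 * n = - (2 * (v 2 0 * (v 2 0)^*)) - n].
Proof.
move=> n0; have nE : n = herm form21 v v by [].
have r i : refl form21 v i i * n = 2 * (v i 0 * (adjoint v *m form21) 0 i) - n.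
  rewrite /refl -nE; clearbody n; rewrite !mxE big_ord1 mxE eqxx.
  by rewrite mulrBl mul1r mulrAC (mulfVK n0).
have p0 : (adjoint v *m form21) 0 0 = (v 0 0)^*.
  by rewrite mxE sum3 !adjointE !mxE /=; ring.
have p1 : (adjoint v *m form21) 0 1 = (v 1 0)^*.
  by rewrite mxE sum3 !adjointE !mxE /=; ring.
have p2 : (adjoint v *m form21) 0 2 = - (v 2 0)^*.
  by rewrite mxE sum3 !adjointE !mxE /=; ring.
by clearbody n; split; rewrite r ?p0 ?p1 ?p2 // !mulrN.
Qed.

(** For a positive X, which stands for <x, x>, the Gram determinant of two vectors
    orthogonal to x is nonpositive; the sign of m1 m2 decides on which side of the
    interval from 0 to 1 the ratio falls. *)
Lemma gram_ratio_indefinite (X g m1 m2 : R) : 0 < X -> X * (m1 * m2 - g) <= 0 -> 0 <= g ->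
  m1 != 0 -> m2 != 0 -> g / (m1 * m2) <= 0 \/ 1 <= g / (m1 * m2).
Proof.
move=> X0; rewrite pmulr_rle0 // subr_le0 => gram g0 n1 n2.
have m0 : m1 * m2 != 0 by rewrite mulf_neq0.
case: (ltrgtP 0 (m1 * m2)) m0 => // m0 _.
  by right; rewrite ler_pdivlMr // mul1r.
by left; rewrite mulr_ge0_le0 // invr_le0 ltW.
Qed.

(** The W_j are the squared moduli of the coordinates of v, so that
    n = W0 + W1 - W2 is <v, v>, and c is the ratio
    |<v1, v2>|^2 / (<v1, v1> <v2, v2>).  The tangent relation is the imaginary
    part of <x, v> = h n for the vector x fixed by A I_v; the cosine relation is
    the real part of n tr (A I_v) = n (4 c - 1); and the expression assumed
    positive in the last clause is <x, x> up to the factor |h|^2. *)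
Lemma three_reflections_weights (a0 a1 a2 : R) v1 v2 v :
  cos (a0 / 2) != 0 -> cos (a1 / 2) != 0 -> cos (a2 / 2) != 0 ->
  herm form21 v1 v1 != 0 -> herm form21 v2 v2 != 0 -> herm form21 v v != 0 ->
  diag3 (expi a0) (expi a1) (expi a2) =
    refl form21 v1 *m refl form21 v2 *m refl form21 v ->
  exists W0 W1 W2 c : R, [/\ [/\ 0 <= W0, 0 <= W1 & 0 <= W2],
    W0 + W1 - W2 != 0,
    W0 * tan (a0 / 2) + W1 * tan (a1 / 2) = W2 * tan (a2 / 2),
    cos a0 * (2 * W0 - (W0 + W1 - W2)) + cos a1 * (2 * W1 - (W0 + W1 - W2))
      - cos a2 * (2 * W2 + (W0 + W1 - W2)) = (4 * c - 1) * (W0 + W1 - W2)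
    & 0 < W0 * (1 + tan (a0 / 2) ^+ 2) + W1 * (1 + tan (a1 / 2) ^+ 2)
          - W2 * (1 + tan (a2 / 2) ^+ 2) -> c <= 0 \/ 1 <= c].
Proof.
move=> c0 c1 c2 n1 n2 n3 A123.
have [x x0 [xv1 xv2]] := orthogonal_pair form21 v1 v2.
have [AR Ax] := fixed_vector A123 (refl_sqr n3) (refl_orthogonal xv1) (refl_orthogonal xv2).
have [n nE'] : exists n, n = herm form21 v v by eexists.
have [h hn] : exists h, h * n = herm form21 x v.
  by exists (herm form21 x v / n); rewrite nE' (mulfVK n3).
have gram := gram_det_le0 xv1 xv2.
have trR := etrans (congr1 mxtrace AR) (tr_refl2 form21_herm n1 n2).
have [s0 s1 s2] := refl_diagonal n3.
rewrite -nE' in n3.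
have [m1 m1E] : exists m1 : R, herm form21 v1 v1 = m1%:C%C.
  by eexists; exact: herm_normsq.
have [m2 m2E] : exists m2 : R, herm form21 v2 v2 = m2%:C%C.
  by eexists; exact: herm_normsq.
rewrite m1E m2E /= in n1 n2 gram trR.
have [g gE] : exists g, g = normsq (herm form21 v1 v2) by eexists.
have g0 : 0 <= g by rewrite gE normsq_ge0.
rewrite normsqE -gE in trR; rewrite -gE in gram; clear gE m1E m2E.
have rx : refl form21 v *m x = (2 * h) *: v - x.
  by rewrite refl_mul -nE' -hn mulrA mulfK.
rewrite rx in Ax.
have [xE0 xE1 xE2] := fixed_vector_diag3 c0 c1 c2 Ax.
have h2 : 2 * h / 2 = h by field.
rewrite h2 in xE0 xE1 xE2.
have h0 : h != 0.
  apply: contraNneq x0 => h0; rewrite [x]cv3_eta xE0 xE1 xE2 h0 !mul0r.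
  by apply/eqP/matrixP; apply: ord3P => j; rewrite !mxE.
have [W0 [W1 [W2 [[p0 p1 p2] [e0 e1 e2]]]]] : exists W0 W1 W2 : R,
    [/\ 0 <= W0, 0 <= W1 & 0 <= W2] /\
    [/\ v 0 0 * (v 0 0)^* = W0%:C%C, v 1 0 * (v 1 0)^* = W1%:C%C
       & v 2 0 * (v 2 0)^* = W2%:C%C].
  exists (normsq (v 0 0)), (normsq (v 1 0)), (normsq (v 2 0)).
  by split; split; rewrite ?normsq_ge0 ?normsqE.
have nE : n = W0%:C%C + W1%:C%C - W2%:C%C by rewrite nE' herm_form21 e0 e1 e2.
have [t0 t0E] : exists t0, t0 = tan (a0 / 2) by eexists.
have [t1 t1E] : exists t1, t1 = tan (a1 / 2) by eexists.
have [t2 t2E] : exists t2, t2 = tan (a2 / 2) by eexists.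
rewrite -t0E -t1E -t2E in xE0 xE1 xE2 *.
exists W0, W1, W2, (g / (m1 * m2)); split.
- by split.
- by apply: contraNneq n3 => e; rewrite nE -rmorphD -rmorphB /= e rmorph0.
- move: hn; rewrite herm_form21 xE0 xE1 xE2 -!mulrA -mulrDr -mulrBr => /(mulfI h0).
  rewrite e0 e1 e2 nE => e.
  have : 'i%C * (W0 * t0 + W1 * t1 - W2 * t2)%:C%C = 0 :> C.
    by rewrite -(subrr (W0%:C%C + W1%:C%C - W2%:C%C)) {1}e rmorphB /= rmorphD !rmorphM /=; ring.
  move/eqP; rewrite mulf_eq0 => /orP[|].
    by rewrite eq_complex /= oner_eq0 andbF.
  by rewrite fmorph_eq0 subr_eq0 => /eqP.
- have {}trR : \tr (diag3 (expi a0) (expi a1) (expi a2) *m refl form21 v) =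
      (4 * (g / (m1 * m2)) - 1)%:C%C.
    rewrite trR rmorphB rmorph1 /= rmorphM /= rmorph_nat fmorph_div /= rmorphM /=.
    by rewrite mulrA.
  have [d0 _ _] := diag3_mul (expi a0) (expi a1) (expi a2) (refl form21 v) 0.
  have [_ d1 _] := diag3_mul (expi a0) (expi a1) (expi a2) (refl form21 v) 1.
  have [_ _ d2] := diag3_mul (expi a0) (expi a1) (expi a2) (refl form21 v) 2.
  rewrite -nE' in s0 s1 s2.
  have r0 : refl form21 v 0 0 * n = (2 * W0 - (W0 + W1 - W2))%:C%C.
    by rewrite s0 e0 nE !rmorphB rmorphD rmorphM /= rmorph_nat.
  have r1 : refl form21 v 1 1 * n = (2 * W1 - (W0 + W1 - W2))%:C%C.
    by rewrite s1 e1 nE !rmorphB rmorphD rmorphM /= rmorph_nat.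
  have r2 : refl form21 v 2 2 * n = (- 2 * W2 - (W0 + W1 - W2))%:C%C.
    by rewrite s2 e2 nE !rmorphB rmorphD rmorphM rmorphN /= rmorph_nat mulNr.
  move: (4 * (g / (m1 * m2)) - 1) trR => k.
  rewrite /mxtrace sum3 d0 d1 d2 => /(congr1 (fun z => z * n)).
  rewrite !mulrDl -!mulrA r0 r1 r2 nE -rmorphD -rmorphB -rmorphM.
  move=> /(congr1 (@complex.Re R)) /=; rewrite !mulr0 !subr0 => e.
  by rewrite -e; ring.
- move=> pos; move: gram.
  have -> : complex.Re (herm form21 x x) = normsq h * (W0 * (1 + t0 ^+ 2) + W1 * (1 + t1 ^+ 2) - W2 * (1 + t2 ^+ 2)).
    have q (t W : R) (z : C) : z * z^* = W%:C%C ->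
        h * (1 + 'i%C * t%:C%C) * z * (h * (1 + 'i%C * t%:C%C) * z)^* =
        (normsq h * (W * (1 + t ^+ 2)))%:C%C.
      move=> zW.
      have -> : (h * (1 + 'i%C * t%:C%C) * z)^* = h^* * (1 - 'i%C * t%:C%C) * z^*.
        rewrite !rmorphM rmorphD rmorph1 rmorphM /=; congr (_ * (1 + _) * _).
        by apply/eqP; rewrite eq_complex /=; apply/andP; split; apply/eqP; ring.
      transitivity (h * h^* * (z * z^*) * (1 - 'i%C ^+ 2 * t%:C%C ^+ 2)); first by ring.
      by rewrite sqr_i zW normsqE; move: (normsq h) => k; rewrite !rmorphM rmorphD rmorph1 rmorphXn /=; ring.
    rewrite herm_form21 xE0 xE1 xE2 (q _ _ _ e0) (q _ _ _ e1) (q _ _ _ e2) /=.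
    by ring.
  have hpos : 0 < normsq h.
    rewrite lt_neqAle normsq_ge0 andbT eq_sym; apply: contraNneq h0 => e.
    by have /eqP := normsqE h; rewrite e rmorph0 mulf_eq0 conjC_eq0 orbb.
  rewrite fmorph_eq0 in n1; rewrite fmorph_eq0 in n2.
  by move=> gram; exact: gram_ratio_indefinite (mulr_gt0 hpos pos) gram g0 n1 n2.
Qed.

End Necessity.

(** * Impossibility in the triangle *)

Section Triangle.
Context {R : realType}.
Local Notation C := R[i]%C.

Lemma weights_sign_absurd (W0 W1 W2 t0 t1 t2 : R) :
  [/\ 0 <= W0, 0 <= W1 & 0 <= W2] -> W0 + W1 - W2 != 0 ->
  W0 * t0 + W1 * t1 = W2 * t2 -> 0 < t0 -> 0 < t1 -> t2 < 0 -> False.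
Proof.
move=> [p0 p1 p2] n0 e q0 q1 q2.
have g0 : 0 <= W0 * t0 by rewrite mulr_ge0 // ltW.
have g1 : 0 <= W1 * t1 by rewrite mulr_ge0 // ltW.
have g2 : W2 * t2 <= 0 by rewrite mulr_ge0_le0 // ltW.
have z0 : W0 * t0 = 0 by lra.
have z1 : W1 * t1 = 0 by lra.
have z2 : W2 * t2 = 0 by lra.
move: z0 z1 z2 => /eqP; rewrite mulf_eq0 (gt_eqF q0) orbF => /eqP z0.
move=> /eqP; rewrite mulf_eq0 (gt_eqF q1) orbF => /eqP z1.
move=> /eqP; rewrite mulf_eq0 (lt_eqF q2) orbF => /eqP z2.
by move/eqP: n0; apply; rewrite z0 z1 z2; ring.
Qed.

(** The weights force n < 0.  Let s2 be the second elementary symmetric function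
    of the t_j, D = 1 - s2, and nq the signed sum of the W_j t_j^2.  As the t_j
    have equal sum and product, C_j D is a quadratic polynomial in t_j, and the
    trace relation collapses to c n D = - (s2 n + nq).  The inequalities
    n + nq > 0 and s2 n + nq < 0 then give both the positivity under which c avoids
    the interval from 0 to 1, and 0 < c < 1. *)
Lemma weights_elliptic_absurd (W0 W1 W2 c t0 t1 t2 C0 C1 C2 : R) :
  [/\ 0 <= W0, 0 <= W1 & 0 <= W2] -> W0 + W1 - W2 != 0 ->
  W0 * t0 + W1 * t1 = W2 * t2 ->
  C0 * (1 + t0 ^+ 2) = 1 - t0 ^+ 2 -> C1 * (1 + t1 ^+ 2) = 1 - t1 ^+ 2 ->
  C2 * (1 + t2 ^+ 2) = 1 - t2 ^+ 2 ->
  C0 * (2 * W0 - (W0 + W1 - W2)) + C1 * (2 * W1 - (W0 + W1 - W2))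
    - C2 * (2 * W2 + (W0 + W1 - W2)) = (4 * c - 1) * (W0 + W1 - W2) ->
  (0 < W0 * (1 + t0 ^+ 2) + W1 * (1 + t1 ^+ 2) - W2 * (1 + t2 ^+ 2) ->
   c <= 0 \/ 1 <= c) ->
  t0 + t1 + t2 = t0 * t1 * t2 ->
  0 < t2 -> t2 < t1 -> t2 < t0 -> 1 < t1 * t2 -> 1 < t0 * t2 -> False.
Proof.
move=> [p0 p1 p2] n0 e hC0 hC1 hC2 tr cP ts q2 q1 q0 g1 g0.
set n := W0 + W1 - W2 in n0 tr.
pose s1 := t0 + t1 + t2; pose s2 := t0 * t1 + t0 * t2 + t1 * t2.
pose D := 1 - s2.
pose nq := W0 * t0 ^+ 2 + W1 * t1 ^+ 2 - W2 * t2 ^+ 2.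
have hs : s1 - t0 * t1 * t2 = 0 by rewrite /s1 ts subrr.
have DC C t : C * (1 + t ^+ 2) = 1 - t ^+ 2 -> t ^+ 3 - s1 * t ^+ 2 + s2 * t - s1 = 0 ->
    C * D = D - 2 * t ^+ 2 + 2 * s1 * t.
  move=> hC root; have X : (1 + t ^+ 2) * (D - t ^+ 2 + s1 * t) = D.
    transitivity (D - t * (t ^+ 3 - s1 * t ^+ 2 + s2 * t - s1)); first by rewrite /D; ring.
    by rewrite root mulr0 subr0.
  transitivity (C * ((1 + t ^+ 2) * (D - t ^+ 2 + s1 * t))); first by rewrite X.
  rewrite mulrA hC.
  transitivity (2 * (D - t ^+ 2 + s1 * t) - (1 + t ^+ 2) * (D - t ^+ 2 + s1 * t)).
    by ring.
  by rewrite X; ring.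
have DC0 := DC _ _ hC0; have DC1 := DC _ _ hC1; have DC2 := DC _ _ hC2.
have root t : (t - t0) * (t - t1) * (t - t2) = 0 -> t ^+ 3 - s1 * t ^+ 2 + s2 * t - s1 = 0.
  move=> z; transitivity ((t - t0) * (t - t1) * (t - t2) - (s1 - t0 * t1 * t2)).
    by rewrite /s1 /s2; ring.
  by rewrite z hs subrr.
have cnD : c * n * D = - (s2 * n + nq).
  have : 4 * (c * n * D) = n * D + (C0 * D) * (2 * W0 - n) + (C1 * D) * (2 * W1 - n)
                           - (C2 * D) * (2 * W2 + n).
    transitivity ((4 * c - 1) * n * D + n * D); first by ring.
    by rewrite -tr; ring.
  rewrite DC0 ?DC1 ?DC2; try by apply: root; ring.
  move=> h.
  have : 4 * (c * n * D) = 4 * (- (s2 * n + nq) + s1 * (W0 * t0 + W1 * t1 - W2 * t2)).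
    by rewrite h /n /nq /D /s1 /s2; ring.
  by rewrite e subrr mulr0 addr0; apply: mulfI; rewrite pnatr_eq0.
have p01 : 0 < t0 * t1 by rewrite mulr_gt0 //; lra.
have p02 : 0 < t0 * t2 by lra.
have p12 : 0 < t1 * t2 by lra.
have W01 : 0 < W0 + W1.
  rewrite lt_neqAle eq_sym addr_ge0 // andbT; apply: contraNneq n0 => z.
  have z0 : W0 = 0 by lra.
  have z1 : W1 = 0 by lra.
  move: e; rewrite /n z0 z1 !mul0r addr0 => /esym/eqP.
  by rewrite mulf_eq0 (gt_eqF q2) orbF => /eqP ->; rewrite subrr.
have comb (x y : R) : 0 < x -> 0 < y -> 0 < W0 * x + W1 * y.
  move=> x0 y0; have [l|] := ltP 0 W0.
    by rewrite ltr_wpDr ?mulr_ge0 ?mulr_gt0 // ltW.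
  move=> l; have l1 : 0 < W1 by lra.
  by rewrite ltr_wpDl ?mulr_ge0 ?mulr_gt0 // ltW.
have nneg : n < 0.
  have := comb _ _ (etrans (subr_gt0 _ _) q0) (etrans (subr_gt0 _ _) q1) => h.
  have : n * t2 < 0.
    have -> : n * t2 = - (W0 * (t0 - t2) + W1 * (t1 - t2)).
      by rewrite /n; transitivity (W0 * t2 + W1 * t2 - W2 * t2); [ring | rewrite -e; ring].
    by rewrite oppr_lt0.
  by rewrite pmulr_llt0.
have nnq : 0 < n + nq.
  have : 0 < (n + nq) * t2.
    have -> : (n + nq) * t2 = W0 * ((t0 - t2) * (t0 * t2 - 1)) + W1 * ((t1 - t2) * (t1 * t2 - 1)).
      transitivity (W0 * (1 + t0 ^+ 2) * t2 + W1 * (1 + t1 ^+ 2) * t2 - (W2 * t2) * (1 + t2 ^+ 2)).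
        by rewrite /n /nq; ring.
      by rewrite -e; ring.
    by apply: comb; rewrite mulr_gt0 // subr_gt0.
  by rewrite pmulr_lgt0.
have s2n : s2 * n + nq < 0.
  have : (s2 * n + nq) * t2 < 0.
    have -> : (s2 * n + nq) * t2 =
        - (W0 * ((t0 - t2) * (s2 - t0 * t2)) + W1 * ((t1 - t2) * (s2 - t1 * t2))).
      transitivity (W0 * (s2 + t0 ^+ 2) * t2 + W1 * (s2 + t1 ^+ 2) * t2 - (W2 * t2) * (s2 + t2 ^+ 2)).
        by rewrite /n /nq; ring.
      by rewrite -e; ring.
    rewrite oppr_lt0; apply: comb; rewrite mulr_gt0 ?subr_gt0 // /s2.
      by lra.
    by lra.
  by rewrite pmulr_llt0.
have nD : 0 < n * D by rewrite nmulr_rgt0 // /D /s2; lra.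
have c0 : 0 < c by have : 0 < c * (n * D) by [rewrite mulrA cnD; lra]; rewrite pmulr_lgt0.
have c1 : c < 1.
  rewrite -subr_gt0; have : 0 < (1 - c) * (n * D).
    by rewrite mulrBl mul1r mulrA cnD /D; lra.
  by rewrite pmulr_lgt0.
case: cP; last by lra.
  by have <- : n + nq = W0 * (1 + t0 ^+ 2) + W1 * (1 + t1 ^+ 2) - W2 * (1 + t2 ^+ 2)
    by rewrite /n /nq; ring.
by lra.
Qed.

Lemma tan_pos (u : R) : 0 < u < pi / 2 -> 0 < tan u.
Proof.
move=> /andP[u0 u1]; rewrite /tan divr_gt0 //.
  by apply: sin_gt0_pihalf; rewrite u0.
by apply: cos_gt0_pihalf; rewrite u1 andbT; lra.
Qed.

Lemma tan_prod_gt1 (u v : R) : 0 < u < pi / 2 -> 0 < v < pi / 2 -> pi / 2 < u + v ->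
  1 < tan u * tan v.
Proof.
move=> /andP[u0 u1] /andP[v0 v1] uv.
have cu : 0 < cos u by apply: cos_gt0_pihalf; rewrite u1 andbT; lra.
have cv : 0 < cos v by apply: cos_gt0_pihalf; rewrite v1 andbT; lra.
have : 0 < sin (u + v - pi / 2) by apply: sin_gt0_pihalf; apply/andP; split; lra.
rewrite sinBpihalf cosD opprB subr_gt0 => h.
by rewrite /tan mulf_div ltr_pdivlMr ?mulr_gt0 // mul1r.
Qed.

Lemma tan_sum (u v w : R) : cos u != 0 -> cos v != 0 -> cos w != 0 ->
  sin (u + v + w) = 0 -> tan u + tan v + tan w = tan u * tan v * tan w.
Proof.
move=> cu cv cw s; apply/eqP; rewrite -subr_eq0; apply/eqP.
have ccc : cos u * cos v * cos w != 0 by rewrite !mulf_neq0.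
apply: (mulfI ccc); rewrite mulr0 -s !(sinD, cosD) /tan; field.
by rewrite cu cv cw.
Qed.

Lemma cos_half_tan (a : R) : cos (a / 2) != 0 ->
  cos a * (1 + tan (a / 2) ^+ 2) = 1 - tan (a / 2) ^+ 2.
Proof.
move=> c0; have e : a = a / 2 + a / 2 by field.
rewrite {1}e; set u := a / 2 in c0 *; rewrite /tan cosD.
have s2 := cos2Dsin2 u.
transitivity ((cos u ^+ 2 - sin u ^+ 2) * (cos u ^+ 2 + sin u ^+ 2) / cos u ^+ 2).
  by field.
by rewrite s2 mulr1; field.
Qed.
Lemma cube_roots (z : C) : z ^+ 3 = 1 ->
  [\/ z = 1, z = expi (2 * pi / 3) | z = expi (- (2 * pi / 3))].
Proof.
have pi0 := pi_gt0 R; set w : C := expi (2 * pi / 3).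
have w1 : w != 1.
  have s0 : 0 < sin (2 * pi / 3 : R) by apply: sin_gt0_pi; apply/andP; split; lra.
  by rewrite eq_complex /= (gt_eqF s0) andbF.
have w3 : w ^+ 3 = 1.
  rewrite !exprS expr0 mulr1 -!expiD.
  rewrite (_ : _ + _ = pi *+ 2); first by rewrite /expi cos2pi sin2pi.
  by rewrite mulr2n; field.
have wV : expi (- (2 * pi / 3)) = w ^+ 2.
  apply: (mulfI (expi_neq0 (2 * pi / 3))); rewrite -expiD subrr expi0 -/w.
  by rewrite -exprS w3.
have wp : 1 + w + w ^+ 2 = 0.
  have : (w - 1) * (1 + w + w ^+ 2) = 0 by transitivity (w ^+ 3 - 1); [ring | rewrite w3 subrr].
  by move/eqP; rewrite mulf_eq0 subr_eq0 (negPf w1) /= => /eqP.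
move=> z3; have : (z - 1) * (z - w) * (z - w ^+ 2) = 0.
  transitivity (z ^+ 3 - w ^+ 3 - (1 + w + w ^+ 2) * (z ^+ 2 - w * z)); first by ring.
  by rewrite z3 w3 wp subrr mul0r subr0.
move/eqP; rewrite !mulf_eq0 !subr_eq0 -wV => /orP[/orP[|]|] /eqP ->.
- by constructor 1.
- by constructor 2.
- by constructor 3.
Qed.

(** The signs with which the J_i differ from reflections are absorbed by the
    scalar. *)
Lemma three_involutions_refl (A : 'M[C]_3) : three_involutions form21 A ->
  exists c v1 v2 v3, [/\ c != 0, herm form21 v1 v1 != 0, herm form21 v2 v2 != 0,
    herm form21 v3 v3 != 0 &
    c *: A = refl form21 v1 *m refl form21 v2 *m refl form21 v3].
Proof.
case=> c [J1 [J2 [J3 [c0 h1 h2 h3 ->]]]].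
have sgn J : unitary_involution form21 J -> exists v s,
    [/\ herm form21 v v != 0, s * s = 1 :> C & J = s *: refl form21 v].
  move=> /(unitary_involution_refl (form21_herm (R:=R)) (form21_unit (R:=R)))[v v0 [->|->]].
    by exists v, 1; rewrite v0 mulr1 scale1r.
  by exists v, (-1); rewrite v0 mulrNN mulr1 scaleN1r.
have [v1 [s1 [n1 ss1 ->]]] := sgn _ h1; have [v2 [s2 [n2 ss2 ->]]] := sgn _ h2.
have [v3 [s3 [n3 ss3 ->]]] := sgn _ h3.
exists (s1 * s2 * s3 / c), v1, v2, v3; split=> //.
  rewrite mulf_neq0 ?invr_eq0 // !mulf_neq0 //.
  - by apply: contra_eq_neq ss1 => ->; rewrite mul0r eq_sym oner_neq0.
  - by apply: contra_eq_neq ss2 => ->; rewrite mul0r eq_sym oner_neq0.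
  - by apply: contra_eq_neq ss3 => ->; rewrite mul0r eq_sym oner_neq0.
rewrite -!scalemxAl -!scalemxAr -!scalemxAl !scalerA.
rewrite (_ : _ * _ = 1) ?scale1r //.
transitivity ((s1 * s1) * (s2 * s2) * (s3 * s3)); first by field.
by rewrite ss1 ss2 ss3 !mulr1.
Qed.

Lemma det_mul3 (A B M : 'M[C]_3) :
  \det A = 1 -> \det B = 1 -> \det M = 1 -> \det (A *m B *m M) = 1.
Proof. by move=> dA dB dM; rewrite !det_mulmx dA dB dM !mulr1. Qed.

(** Reflections have determinant 1, which determines the scalar up to a cube root
    of unity. *)
Lemma three_involutions_lift (a0 a1 a2 : R) : a0 + a1 + a2 = 0 ->
  three_involutions form21 (diag3 (expi a0) (expi a1) (expi a2)) ->
  exists v1 v2 v3 (s : R),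
   [/\ herm form21 v1 v1 != 0, herm form21 v2 v2 != 0, herm form21 v3 v3 != 0,
      diag3 (expi (a0 + s)) (expi (a1 + s)) (expi (a2 + s)) =
      refl form21 v1 *m refl form21 v2 *m refl form21 v3 &
      [\/ s = 0, s = 2 * pi / 3 | s = - (2 * pi / 3)]].
Proof.
move=> a012 /three_involutions_refl[c [v1 [v2 [v3 [c0 n1 n2 n3 e]]]]].
have c3 : c ^+ 3 = 1.
  have := etrans (congr1 determinant e) (det_mul3 (det_refl n1) (det_refl n2) (det_refl n3)).
  rewrite detZ det_mx3 => <-.
  transitivity (c ^+ 3 * (expi a0 * expi a1 * expi a2)).
    by rewrite -!expiD a012 expi0 mulr1.
  by ring.
suff [s cE sE] : exists2 s : R, c = expi s & [\/ s = 0, s = 2 * pi / 3 | s = - (2 * pi / 3)].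
  exists v1, v2, v3, s; split=> //.
  by rewrite -e scale_diag3 cE -!expiD ![s + _]addrC.
case: (cube_roots c3) => ->.
- by exists 0; [rewrite expi0 | constructor 1].
- by exists (2 * pi / 3); [| constructor 2].
- by exists (- (2 * pi / 3)); [| constructor 3].
Qed.

Lemma cos_half_neq0 (a : R) : - pi < a < pi -> cos (a / 2) != 0.
Proof.
by move=> /andP[h1 h2]; apply: lt0r_neq0; apply: cos_gt0_pihalf; apply/andP; split; lra.
Qed.

Lemma expi_periodic (a : R) : expi (a + 2 * pi) = expi a.
Proof. by rewrite /expi mulr_natl cosD2pi sinD2pi. Qed.

(** For the shift 0 the first two tangents are positive and the third is
    negative; for the shift - 2 pi / 3 all these signs are reversed.  For the shift
    2 pi / 3 the half angles lie in the first quadrant, where both hypotheses on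
    products of tangents come from 2 t1 - t2 < pi. *)
Lemma triangle_not_three_involutions (t1 t2 : R) :
  0 < t2 -> t2 < t1 -> pi < t1 + t2 -> 2 * t1 - t2 < pi ->
  ~ three_involutions form21 (diag3 (expi ((2 * t1 - t2) / 3))
      (expi ((2 * t2 - t1) / 3)) (expi (- (t1 + t2) / 3))).
Proof.
move=> t20 t21 h1 h2 /three_involutions_lift; have pi0 := pi_gt0 R.
case; first by field.
move=> v1 [v2 [v3 [s [n1 n2 n3 e sE]]]].
case: sE e => ->.
- set a0 := _ / 3 + 0; set a1 := _ / 3 + 0; set a2 := _ / 3 + 0 => e.
  have b0 : - pi < a0 < pi by rewrite /a0; apply/andP; split; lra.
  have b1 : - pi < a1 < pi by rewrite /a1; apply/andP; split; lra.
  have b2 : - pi < a2 < pi by rewrite /a2; apply/andP; split; lra.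
  have [W0 [W1 [W2 [c [p nz ew _ _]]]]] := three_reflections_weights
    (cos_half_neq0 b0) (cos_half_neq0 b1) (cos_half_neq0 b2) n1 n2 n3 e.
  apply: (weights_sign_absurd p nz ew).
  + by apply: tan_pos; rewrite /a0; apply/andP; split; lra.
  + by apply: tan_pos; rewrite /a1; apply/andP; split; lra.
  + by rewrite -oppr_gt0 -tanN; apply: tan_pos; rewrite /a2; apply/andP; split; lra.
- set a0 := _ / 3 + _; set a1 := _ / 3 + _; set a2 := _ / 3 + _ => e.
  have b0 : - pi < a0 < pi by rewrite /a0; apply/andP; split; lra.
  have b1 : - pi < a1 < pi by rewrite /a1; apply/andP; split; lra.
  have b2 : - pi < a2 < pi by rewrite /a2; apply/andP; split; lra.
  have cb0 := cos_half_neq0 b0; have cb1 := cos_half_neq0 b1.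
  have cb2 := cos_half_neq0 b2.
  have [W0 [W1 [W2 [c [p nz ew tr cP]]]]] := three_reflections_weights cb0 cb1 cb2 n1 n2 n3 e.
  have u0 : 0 < a0 / 2 < pi / 2 by rewrite /a0; apply/andP; split; lra.
  have u1 : 0 < a1 / 2 < pi / 2 by rewrite /a1; apply/andP; split; lra.
  have u2 : 0 < a2 / 2 < pi / 2 by rewrite /a2; apply/andP; split; lra.
  have I (u : R) : 0 < u < pi / 2 -> u \in `](- (pi / 2)), (pi / 2)[.
    by move=> /andP[? ?]; rewrite in_itv /=; apply/andP; split; lra.
  apply: (weights_elliptic_absurd p nz ew (cos_half_tan cb0) (cos_half_tan cb1)
    (cos_half_tan cb2) tr cP).
  + apply: tan_sum => //; rewrite (_ : _ + _ = pi) ?sinpi //.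
    by rewrite /a0 /a1 /a2; field.
  + exact: tan_pos.
  + by rewrite ltr_tan ?I // /a1 /a2; lra.
  + by rewrite ltr_tan ?I // /a0 /a2; lra.
  + by apply: tan_prod_gt1 => //; rewrite /a1 /a2; lra.
  + by apply: tan_prod_gt1 => //; rewrite /a0 /a2; lra.
- set a0 := _ / 3 + _; set a1 := _ / 3 + _; set a2' := _ / 3 + _.
  rewrite -(expi_periodic a2'); set a2 := a2' + _ => e.
  have b0 : - pi < a0 < pi by rewrite /a0; apply/andP; split; lra.
  have b1 : - pi < a1 < pi by rewrite /a1; apply/andP; split; lra.
  have b2 : - pi < a2 < pi by rewrite /a2 /a2'; apply/andP; split; lra.
  have [W0 [W1 [W2 [c [p nz ew _ _]]]]] := three_reflections_weights
    (cos_half_neq0 b0) (cos_half_neq0 b1) (cos_half_neq0 b2) n1 n2 n3 e.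
  have ew' : W0 * - tan (a0 / 2) + W1 * - tan (a1 / 2) = W2 * - tan (a2 / 2).
    by rewrite !mulrN -ew; ring.
  apply: (weights_sign_absurd p nz ew').
  + by rewrite -tanN; apply: tan_pos; rewrite /a0; apply/andP; split; lra.
  + by rewrite -tanN; apply: tan_pos; rewrite /a1; apply/andP; split; lra.
  + by rewrite oppr_lt0; apply: tan_pos; rewrite /a2 /a2'; apply/andP; split; lra.
Qed.

End Triangle.

(** * Angle pairs and the two triangles *)

Section Assembly.
Context {R : realType}.
Local Notation C := R[i]%C.

Lemma three_involutions_swap (a b c : C) :
  three_involutions form21 (diag3 a b c) -> three_involutions form21 (diag3 b a c).
Proof.
pose P : 'M[C]_3 := mx3 0 1 0 1 0 0 0 0 1.
have PP : P *m P = 1%:M by rewrite mul_mx3 mx3_1; congr mx3; ring.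
have [uP _] := mulmx1_unit PP.
have PV : invmx P = P by rewrite -[LHS]mulmx1 -PP mulKmx.
move=> /(three_involutions_conj uP).
rewrite PV adjoint_mx3 !mul_mx3 !rmorph0 !rmorph1 => h.
by move: h; congr (three_involutions _ _); congr mx3; ring.
Qed.

Lemma three_involutions_inv (H A B : 'M[C]_3) : A *m B = 1%:M ->
  three_involutions H A -> three_involutions H B.
Proof.
move=> AB [c [J1 [J2 [J3 [c0 h1 h2 h3 e]]]]].
have [_ s1 _] := h1; have [_ s2 _] := h2; have [_ s3 _] := h3.
exists c^-1, J3, J2, J1; split; rewrite ?invr_eq0 //.
suff BA : c^-1 *: (J3 *m J2 *m J1) *m A = 1%:M.
  by rewrite -[RHS]mulmx1 -AB mulmxA BA mul1mx.
rewrite e -scalemxAl -scalemxAr scalerA mulVf // scale1r !mulmxA.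
by rewrite -(mulmxA _ J1 J1) s1 mulmx1 -(mulmxA _ J2 J2) s2 mulmx1 s3.
Qed.

(** The lift of determinant 1, one of three, of an elliptic element with angle
    pair (t1, t2), in an orthonormal eigenbasis. *)
Definition elliptic_lift (t1 t2 : R) : 'M[C]_3 :=
  diag3 (expi ((2 * t1 - t2) / 3)) (expi ((2 * t2 - t1) / 3))
        (expi (- (t1 + t2) / 3)).

Lemma three_involutions_shift (s a b c a' b' c' : R) :
  expi a' = expi (s + a) -> expi b' = expi (s + b) -> expi c' = expi (s + c) ->
  three_involutions form21 (diag3 (expi a') (expi b') (expi c')) <->
  three_involutions form21 (diag3 (expi a) (expi b) (expi c)).
Proof.
move=> -> -> ->; rewrite !expiD -scale_diag3.
by apply: three_involutionsZ; exact: expi_neq0.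
Qed.

(** The inverse of a product of three involutions is such a product.  Inverting
    the lift exchanges the roles of the first two eigenvalues, and shifts the
    arguments by 2 pi / 3. *)
Lemma three_involutions_mirror (t1 t2 : R) :
  three_involutions form21 (elliptic_lift t1 t2) ->
  three_involutions form21 (elliptic_lift (2 * pi - t2) (2 * pi - t1)).
Proof.
have inv : elliptic_lift t1 t2 *m diag3 (expi (- ((2 * t1 - t2) / 3)))
    (expi (- ((2 * t2 - t1) / 3))) (expi (- (- (t1 + t2) / 3))) = 1%:M.
  by rewrite mul_diag3 -!expiD !subrr !expi0 mx3_1.
move=> /(three_involutions_inv inv)/three_involutions_swap.
apply: (iffRL (three_involutions_shift (s := 2 * pi / 3) _ _ _)).
- by congr expi; field.
- by congr expi; field.
- by rewrite -expi_periodic; congr expi; field.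
Qed.

Lemma expi_pi : expi pi = -1 :> C.
Proof. by apply/eqP; rewrite eq_complex /= cospi sinpi oppr0 !eqxx. Qed.

(** For pi < 2 t1 - t2 the lift shifted by 2 pi / 3 works, with the second
    eigenvalue in the role of l; for t1 + t2 <= pi the lift shifted by
    - 2 pi / 3 works, with the first eigenvalue in that role.  On the edge
    2 t1 - t2 = pi the lift shifted by 2 pi / 3 has first eigenvalue -1. *)
Lemma outside_triangle_three_involutions (t1 t2 : R) :
  0 < t2 -> t2 < t1 -> t1 + t2 <= 2 * pi ->
  t1 + t2 <= pi \/ pi <= 2 * t1 - t2 ->
  three_involutions form21 (elliptic_lift t1 t2).
Proof.
move=> h0 h12 hs; have pi0 := pi_gt0 R.
have [h _|h [h'|h']] := ltP pi (2 * t1 - t2).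
- apply: three_involutions_swap.
  pose x := (2 * t2 - t1) / 3 + 2 * pi / 3; pose y := - (t1 + t2) / 3 + 2 * pi / 3.
  apply: (iffLR (three_involutions_shift (s := 2 * pi / 3) (a' := x)
     (b' := - (x + y)) (c' := y) _ _ _)).
  + by congr expi; rewrite /x addrC.
  + by rewrite -expi_periodic /x /y; congr expi; field.
  + by congr expi; rewrite /y addrC.
  have sx : 0 < sin x by apply: sin_gt0_pi; rewrite /x; apply/andP; split; lra.
  apply: three_involutions_of_elliptic_angle.
    by rewrite mulr_ge0 ?(ltW sx) //; apply: sin_ge0_pi; rewrite /y; apply/andP; split; lra.
  rewrite !mulr_gt0 //.
    by apply: cos_gt0_pihalf; rewrite /x /y; apply/andP; split; lra.
  by apply: sin_gt0_pi; rewrite /x /y; apply/andP; split; lra.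
- pose x := (2 * t1 - t2) / 3 - 2 * pi / 3; pose y := - (t1 + t2) / 3 - 2 * pi / 3.
  apply: (iffLR (three_involutions_shift (s := - (2 * pi / 3)) (a' := x)
     (b' := - (x + y)) (c' := y) _ _ _)).
  + by congr expi; rewrite /x addrC.
  + by rewrite -[RHS]expi_periodic /x /y; congr expi; field.
  + by congr expi; rewrite /y addrC.
  have sx : sin x < 0.
    by rewrite -oppr_gt0 -sinN; apply: sin_gt0_pi; rewrite /x; apply/andP; split; lra.
  apply: three_involutions_of_elliptic_angle.
    rewrite -mulrNN -!sinN mulr_ge0 //; apply: sin_ge0_pi.
      by rewrite /x; apply/andP; split; lra.
    by rewrite /y; apply/andP; split; lra.
  rewrite nmulr_lgt0 // nmulr_rlt0.
    by apply: sin_gt0_pi; rewrite /x /y; apply/andP; split; lra.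
  rewrite -oppr_gt0 -cosDpi; apply: cos_gt0_pihalf; rewrite /x /y.
  by apply/andP; split; lra.
- have e : t1 = (pi + t2) / 2 by lra.
  apply: three_involutions_swap.
  pose x := pi / 2 + t2 / 2.
  have cx : cos x != 0.
    rewrite /x addrC cosDpihalf oppr_eq0 gt_eqF //.
    by apply: sin_gt0_pi; apply/andP; split; lra.
  have := three_involutions_in_complex_line cx.
  rewrite -expi_pi.
  have -> : - expi (- x) = expi (pi - x) :> C.
    by rewrite expiD expi_pi mulN1r.
  apply: (iffLR (three_involutions_shift (s := 2 * pi / 3) _ _ _)).
  + by congr expi; rewrite /x e; field.
  + by congr expi; rewrite e; field.
  + by congr expi; rewrite /x e; field.
Qed.

Lemma three_involutions_elliptic_lift (t1 t2 : R) :
  0 < t2 -> t2 < t1 -> t1 + t2 <= 2 * pi ->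
  three_involutions form21 (elliptic_lift t1 t2) <->
  ~ (pi < t1 + t2 /\ 2 * t1 - t2 < pi).
Proof.
move=> h0 h12 hs; split.
  by move=> h [h1 h2]; exact: triangle_not_three_involutions h0 h12 h1 h2 h.
move=> nT; apply: outside_triangle_three_involutions => //.
have [|h1] := leP (t1 + t2) pi; first by left.
by right; rewrite leNgt; apply/negP => h2; apply: nT.
Qed.

(** The three inequalities are the positivity of the barycentric
    coordinates. *)
Lemma open_triangle_low (t1 t2 : R) :
  open_triangle (pi, pi) (2 * pi / 3, pi / 3) (pi / 2, pi / 2) (t1, t2) <->
  [/\ t2 < t1, pi < t1 + t2 & 2 * t1 - t2 < pi].
Proof.
have := pi_gt0 R; move: (pi : R) => p pi0; have pin0 : p != 0 by rewrite gt_eqF.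
split.
  case=> a [b [c [a0 b0 c0 abc [-> ->]]]].
  have ap : 0 < a * p by rewrite mulr_gt0.
  have bp : 0 < b * p by rewrite mulr_gt0.
  have cp : 0 < c * p by rewrite mulr_gt0.
  have s : a * p + b * p + c * p = p by rewrite -!mulrDl abc mul1r.
  by split; lra.
move=> [h1 h2 h3].
exists ((t1 + t2 - p) / p), (3 * (t1 - t2) / p), (2 * (p - (2 * t1 - t2)) / p).
split.
- by rewrite divr_gt0 // subr_gt0.
- by rewrite divr_gt0 // mulr_gt0 // subr_gt0.
- by rewrite divr_gt0 // mulr_gt0 // subr_gt0.
- by field.
- by congr (_, _) => /=; field.
Qed.

(** The reflection (t1, t2) -> (2 pi - t2, 2 pi - t1) matches the vertices of the
    two triangles in the listed order. *)
Lemma open_triangle_high (t1 t2 : R) :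
  open_triangle (pi, pi) (5 * pi / 3, 4 * pi / 3) (3 * pi / 2, 3 * pi / 2) (t1, t2) <->
  open_triangle (pi, pi) (2 * pi / 3, pi / 3) (pi / 2, pi / 2)
    (2 * pi - t2, 2 * pi - t1).
Proof.
split=> -[a [b [c [a0 b0 c0 abc [e1 e2]]]]]; exists a, b, c; split=> //=.
  rewrite e1 e2; have -> : a = 1 - b - c by lra.
  by congr (_, _); field.
have -> : t1 = 2 * pi - (2 * pi - t1) by ring.
have -> : t2 = 2 * pi - (2 * pi - t2) by ring.
rewrite e1 e2; have -> : a = 1 - b - c by lra.
by congr (_, _); field.
Qed.

Lemma three_involutions_triangles (t1 t2 : R) : 0 < t2 -> t2 < t1 -> t1 < 2 * pi ->
  three_involutions form21 (elliptic_lift t1 t2) <->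
  ~ open_triangle (pi, pi) (2 * pi / 3, pi / 3) (pi / 2, pi / 2) (t1, t2) /\
  ~ open_triangle (pi, pi) (5 * pi / 3, 4 * pi / 3) (3 * pi / 2, 3 * pi / 2) (t1, t2).
Proof.
move=> h0 h12 h1; rewrite open_triangle_high !open_triangle_low.
have [hs|hs] := leP (t1 + t2) (2 * pi).
  rewrite three_involutions_elliptic_lift //.
  split=> [n|[n _] [a b]]; last by apply: n.
  by split=> -[a b c]; [apply: n | lra].
rewrite (_ : three_involutions _ _ <->
   three_involutions form21 (elliptic_lift (2 * pi - t2) (2 * pi - t1))); last first.
  split; first exact: three_involutions_mirror.
  by move=> /three_involutions_mirror; rewrite !subKr.
rewrite three_involutions_elliptic_lift; [| lra | lra | lra].
split=> [n|[_ n] [a b]]; last by apply: n; split=> //; lra.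
by split=> -[a b c]; [lra | apply: n].
Qed.

Lemma expi_2pi_nat (n : nat) : expi (n%:R * (2 * pi)) = 1 :> C.
Proof.
elim: n => [|n IH]; first by rewrite mul0r expi0.
by rewrite -natr1 mulrDl mul1r expi_periodic.
Qed.

Lemma expi_eq_mod2pi (x y : R) : eq_mod2pi x y -> expi x = expi y.
Proof.
case=> k ->; rewrite expiD [X in _ * X](_ : _ = 1) ?mulr1 //.
case: k => n; first exact: expi_2pi_nat.
by rewrite NegzE mulrNz mulNr -expi_conj expi_2pi_nat rmorph1.
Qed.

Lemma orthonormalize (H P : 'M[C]_3) : orthogonal_basis21 H P ->
  exists s0 s1 s2 : C, [/\ s0 != 0, s1 != 0, s2 != 0 &
    adjoint (P *m diag3 s0 s1 s2) *m H *m (P *m diag3 s0 s1 s2) = form21].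
Proof.
case=> uP ortho p0 p1 p2.
have gram i j : (adjoint P *m H *m P) i j = herm H (col j P) (col i P).
  rewrite /herm -[in RHS](mul1mx H) !mxE; apply: eq_bigr => k _.
  rewrite !mxE; congr (_ * _); rewrite mul1mx; apply: eq_bigr => l _.
  by rewrite !mxE.
have nrm (h : C) : 0 < h -> exists2 s : C, s != 0 & s^* * h * s = 1.
  case: h => a b; rewrite ltcE /= => /andP[/eqP -> a0].
  have sa : Num.sqrt a != 0 by rewrite sqrtr_eq0 -ltNge.
  exists (((Num.sqrt a)^-1)%:C)%C; first by rewrite fmorph_eq0 invr_eq0.
  rewrite (_ : (_%:C)%C^* = ((Num.sqrt a)^-1)%:C%C); last exact: conjc_real.
  rewrite -[(a +i* 0)%C]/(a%:C%C) -!rmorphM /= -{2}(sqr_sqrtr (ltW a0)).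
  by rewrite expr2 mulKf // mulfV // rmorph1.
have [s0 n0 e0] := nrm _ p0; have [s1 n1 e1] := nrm _ p1.
have [s2 n2 e2] : exists2 s : C, s != 0 & s^* * herm H (col 2 P) (col 2 P) * s = -1.
  have [|s ns e] := nrm (- herm H (col 2 P) (col 2 P)); first by rewrite oppr_gt0.
  by exists s => //; rewrite -e mulrN mulNr opprK.
exists s0, s1, s2; split=> //.
rewrite adjoint_mul !mulmxA -(mulmxA (adjoint (diag3 _ _ _))) -(mulmxA (adjoint (diag3 _ _ _))).
rewrite [adjoint P *m H *m P]mx3_eta !gram adjoint_mx3 !rmorph0.
(* The six off-diagonal Gram entries vanish by orthogonality. *)
by rewrite ?[herm _ (col 1 P) (col 0 P)]ortho ?[herm _ (col 2 P) (col 0 P)]ortho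
  ?[herm _ (col 0 P) (col 1 P)]ortho ?[herm _ (col 2 P) (col 1 P)]ortho
  ?[herm _ (col 0 P) (col 2 P)]ortho ?[herm _ (col 1 P) (col 2 P)]ortho //
  -/(diag3 _ _ _) -/(diag3 _ _ _) !mul_diag3 e0 e1 e2.
Qed.

(** In an orthonormal eigenbasis a lift is diagonal, and it is the product of
    [elliptic_lift] by the scalar e^(i (c + (t1 + t2) / 3)), where e^(i c) is the
    eigenvalue of the negative eigenvector. *)
Lemma angle_pair_three_involutions (H : 'M[C]_3) (E : PU21 H) (t1 t2 : R) :
  angle_pair E t1 t2 ->
  product_of_three_involutions E <-> three_involutions form21 (elliptic_lift t1 t2).
Proof.
case=> u [P [a [b [c [uE basis [ea eb ec] tE]]]]].
have [uP _ p0 _ _] := basis.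
have H0 : H != 0.
  by apply: contraTneq p0 => ->; rewrite /herm mulmx0 mul0mx mxE ltxx.
have [s0 [s1 [s2 [n0 n1 n2 PH]]]] := orthonormalize basis.
set S := diag3 s0 s1 s2 in PH.
have uS : S \in unitmx.
  rewrite unitmxE det_mx3 unitfE !(mul0r, mulr0, subr0, addr0).
  by rewrite !mulf_neq0.
have uPS : P *m S \in unitmx by rewrite unitmx_mul uP.
have eP : val u *m P = P *m diag3 (expi a) (expi b) (expi c).
  apply/matrixP => i; apply: ord3P.
  - have /matrixP/(_ i 0) := ea; rewrite !mxE => e; rewrite [RHS]sum3 !mxE /=.
    by rewrite !mulr0 !addr0 mulrC -e; apply: eq_bigr => k _; rewrite !mxE.
  - have /matrixP/(_ i 0) := eb; rewrite !mxE => e; rewrite [RHS]sum3 !mxE /=.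
    by rewrite !mulr0 addr0 add0r mulrC -e; apply: eq_bigr => k _; rewrite !mxE.
  - have /matrixP/(_ i 0) := ec; rewrite !mxE => e; rewrite [RHS]sum3 !mxE /=.
    by rewrite !mulr0 !add0r mulrC -e; apply: eq_bigr => k _; rewrite !mxE.
rewrite (product_of_three_involutionsP H0 uE) (three_involutions_conjE _ _ uPS) PH.
have -> : invmx (P *m S) *m val u *m (P *m S) = diag3 (expi a) (expi b) (expi c).
  rewrite -mulmxA (mulmxA (val u)) eP -mulmxA.
  have -> : diag3 (expi a) (expi b) (expi c) *m S = S *m diag3 (expi a) (expi b) (expi c).
    by rewrite !mul_diag3; congr diag3; exact: mulrC.
  by rewrite (mulmxA P) mulKmx.
have lift t t' a' b' : eq_mod2pi t (a' - c) -> eq_mod2pi t' (b' - c) ->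
    three_involutions form21 (diag3 (expi a') (expi b') (expi c)) <->
    three_involutions form21 (elliptic_lift t t').
  move=> /expi_eq_mod2pi ta /expi_eq_mod2pi tb.
  apply: (three_involutions_shift (s := c + (t + t') / 3)).
  - rewrite (_ : _ + _ = c + t); last by field.
    by rewrite expiD ta -expiD; congr expi; ring.
  - rewrite (_ : _ + _ = c + t'); last by field.
    by rewrite expiD tb -expiD; congr expi; ring.
  - by congr expi; field.
case: tE => -[ta tb]; first exact: lift.
rewrite -(lift _ _ _ _ ta tb).
by split; exact: three_involutions_swap.
Qed.
End Assembly.

Unset Implicit Arguments.

Theorem corollary4 (R : realType) (H : 'M[R[i]%C]_3) (sigH : signature21 H)
    (E : PU21 H) (theta1 theta2 : R)
    (regE : regular_elliptic E) (angE : angle_pair E theta1 theta2)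
    (theta2_gt0 : 0 < theta2) (theta2_lt1 : theta2 < theta1)
    (theta1_lt2pi : theta1 < 2 * pi) :
  product_of_three_involutions E <->
  (~ open_triangle (pi, pi) (2 * pi / 3, pi / 3) (pi / 2, pi / 2)
       (theta1, theta2)) /\
  (~ open_triangle (pi, pi) (5 * pi / 3, 4 * pi / 3) (3 * pi / 2, 3 * pi / 2)
       (theta1, theta2)).
Proof.
rewrite (angle_pair_three_involutions angE).
exact: three_involutions_triangles.
Qed.
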